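(* Let $N\in\{2,3\}$, let $\alpha\in\mathbb{R}$ if $N=2$ and $\alpha<0$ if $N=3$, and let $1<p<\infty$ if $N=2$ and $1<p<2$ if $N=3$. Let $\phi_0\in X_0$ be the (unique) positive radially symmetric solution of $-\Delta_\alpha\phi+|\phi|^{p-1}\phi=0$ on $\mathbb{R}^N$, i.e. the unique positive element of $\mathcal{A}_0$. Then there exist $c,C>0$ such that $$c\,r^{-\frac{2}{p-1}}\le\phi_0(r)\le C\,r^{-\frac{2}{p-1}}\qquad\text{for all } r\ge1.$$ In particular, when $N=2$, $\phi_0\in L^2(\mathbb{R}^2)$ if and only if $1<p<3$; and when $N=3$, $\phi_0\in L^2(\mathbb{R}^3)$ for all $1<p<2$.
   Context: All functions are complex valued and $\langle u,v\rangle=\int_{\mathbb{R}^N}u\overline{v}\,dx$. For $\lambda>0$, $G_\lambda\in L^2(\mathbb{R}^N)$ is the solution of $(\lambda-\Delta)G_\lambda=\delta_0$ in $\mathcal{D}'$. Set $\beta(\lambda)=\frac{1}{2\pi}\bigl(\gamma+\log\frac{\sqrt\lambda}{2}\bigr)$ if $N=2$ ($\gamma$ the Euler–Mascheroni constant) and $\beta(\lambda)=\frac{\sqrt\lambda}{4\pi}$ if $N=3$. $-\Delta_\alpha$ is the Laplacian with point interaction of strength $\alpha$ at the origin, used here through its form on $X_0=\{f+cG_\lambda: f\in L^{p+1}(\mathbb{R}^N),\,\nabla f\in L^2(\mathbb{R}^N),\,c\in\mathbb{C}\}$: for $u=f+cG_\lambda$, $v=g+dG_\lambda$ in $X_0$,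 $$\langle-\Delta_\alpha u,v\rangle=\langle\nabla f,\nabla g\rangle+(\alpha+\beta(\lambda)+\lambda\|G_\lambda\|_{L^2}^2)c\overline d-\lambda\overline d\langle u,G_\lambda\rangle-\lambda c\overline{\langle v,G_\lambda\rangle},$$ which is independent of $\lambda>0$. $\mathcal{A}_0$ is the set of $\phi\in X_0$, $\phi\ne0$, such that $\langle-\Delta_\alpha\phi,w\rangle+\int|\phi|^{p-1}\phi\overline w\,dx=0$ for all $w\in X_0$. It is known (another theorem of the paper) that there is a unique positive, radial, decreasing function $\phi_0$ with $\mathcal{A}_0=\{e^{i\theta}\phi_0:\theta\in\mathbb{R}\}$; $\phi_0(r)$ denotes its value at $|x|=r$. *)

(* Defs.v *)
From HB Require Import structures.
From mathcomp Require Import all_boot all_order all_algebra.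
From mathcomp Require Import all_classical all_reals all_analysis.
From mathcomp Require Import complex.

Set Implicit Arguments.
Unset Strict Implicit.
Unset Printing Implicit Defensive.

Import Order.TTheory GRing.Theory Num.Theory.
Import numFieldNormedType.Exports.

Local Open Scope classical_set_scope.
Local Open Scope ring_scope.

Fact rV_display : measure_display. Proof. exact. Qed.

Section rV_measurable.
Context {R : realType} (n : nat).

Definition rV_coor (i : 'I_n) (x : 'rV[R]_n) : R := x 0 i.

Let rV_set0 : g_sigma_preimage rV_coor set0.
Proof. exact: sigma_algebra0. Qed.

Let rV_setC A : g_sigma_preimage rV_coor A -> g_sigma_preimage rV_coor (~` A).
Proof. exact: sigma_algebraC. Qed.

Let rV_bigcup (F : (set 'rV[R]_n)^nat) :
  (forall i, g_sigma_preimage rV_coor (F i)) ->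
  g_sigma_preimage rV_coor (\bigcup_i (F i)).
Proof. exact: sigma_algebra_bigcup. Qed.

(* The Borel sigma-algebra of R^n, generated by the coordinates *)
HB.instance Definition _ := @isMeasurable.Build rV_display
  'rV[R]_n (g_sigma_preimage rV_coor) rV_set0 rV_setC rV_bigcup.

End rV_measurable.

(* This instance of the library is shadowed by the one for subprobabilities *)
Lemma sigma_finite_product d1 d2 (T1 : measurableType d1)
    (T2 : measurableType d2) (R : realType)
    (m1 : {sigma_finite_measure set T1 -> \bar R})
    (m2 : {sigma_finite_measure set T2 -> \bar R}) :
  sigma_finite setT (m1 \x m2)%E.
Proof.
have /sigma_finiteP[F [TF ndF Foo]] := sigma_finiteT m1.
have /sigma_finiteP[G [TG ndG Goo]] := sigma_finiteT m2.
exists (fun n => F n `*` G n).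
  rewrite -setXTT TF TG predeqE => -[x y]; split; last first.
    by move=> [n _ []/= ? ?]; split; exists n.
  move=> [/= [n _ Fnx] [k _ Gky]]; exists (maxn n k) => //; split.
  - by move: x Fnx; exact/subsetPset/ndF/leq_maxl.
  - by move: y Gky; exact/subsetPset/ndG/leq_maxr.
move=> k; have [mF Fk] := Foo k; have [mG Gk] := Goo k.
split; first exact: measurableX.
by rewrite product_measure1E// lte_mul_pinfty// ge0_fin_numE.
Qed.

Section rV_lebesgue.
Context {R : realType}.

Lemma measurable_rV_coor n (i : 'I_n) :
  measurable_fun [set: 'rV[R]_n] (fun x : 'rV[R]_n => x 0 i).
Proof.
move=> _ Y mY; rewrite setTI; apply: sub_sigma_algebra => /=.
rewrite -bigcup_seq/=; exists i => /=; first by rewrite mem_index_enum.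
by exists Y => //; rewrite setTI.
Qed.

Lemma measurable_fun_rV d (T : measurableType d) n (f : T -> 'rV[R]_n) :
  (forall i, measurable_fun [set: T] (fun t => f t 0 i)) ->
  measurable_fun [set: T] f.
Proof.
move=> mf _ A mA; rewrite setTI.
have : g_sigma_preimage (fun i t => f t 0 i) (f @^-1` A).
  rewrite (@g_sigma_preimage_comp _ R n 'rV[R]_n (@rV_coor R n) T f).
  by exists A => //; rewrite setTI.
apply: smallest_sub; first exact: sigma_algebra_measurable.
by rewrite -bigcup_seq => B [i _ [C mC <-]]; exact: mf.
Qed.

Definition rV_cons n (z : measurableTypeR R * 'rV[R]_n) : 'rV[R]_n.+1 :=
  row_mx (z.1 : R)%:M z.2.

Definition rV_uncons n (x : 'rV[R]_n.+1) : measurableTypeR R * 'rV[R]_n :=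
  (x 0 ord0, \row_j x 0 (lift ord0 j)).

Lemma rV_cons0 n z : @rV_cons n z 0 ord0 = z.1.
Proof.
have -> : ord0 = lshift n (ord0 : 'I_1) :> 'I_n.+1 by exact/val_inj.
by apply: (etrans (row_mxEl _ _ _ _)); rewrite mxE.
Qed.

Lemma rV_consS n z j : @rV_cons n z 0 (lift ord0 j) = z.2 0 j.
Proof.
have -> : lift ord0 j = rshift 1 j :> 'I_n.+1 by exact/val_inj.
exact: (etrans (row_mxEr _ _ _ _)).
Qed.

Lemma rV_consK n : cancel (@rV_cons n) (@rV_uncons n).
Proof.
case=> a x; congr (_, _); first exact: rV_cons0.
by apply/rowP => j; rewrite mxE rV_consS.
Qed.

Lemma measurable_rV_cons n : measurable_fun [set: _] (@rV_cons n).
Proof.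
apply: measurable_fun_rV => i; case: (unliftP ord0 i) => [j|] ->.
  under eq_fun do rewrite rV_consS.
  exact: (measurableT_comp (measurable_rV_coor j) measurable_snd).
under eq_fun do rewrite rV_cons0.
exact: measurable_fst.
Qed.

Lemma measurable_rV_uncons n : measurable_fun [set: _] (@rV_uncons n).
Proof.
apply/measurable_fun_pairP; split; first exact: measurable_rV_coor.
apply: measurable_fun_rV => i /=.
by under eq_fun do rewrite mxE; exact: measurable_rV_coor.
Qed.

Section step.
Variables (n : nat) (mu : {sigma_finite_measure set 'rV[R]_n -> \bar R}).

Definition rV_cons_measure : set 'rV[R]_n.+1 -> \bar R :=
  pushforward (@lebesgue_measure R \x mu)%E (@rV_cons n).

Let pfm := measure_function_pushforward__canonical__measure_function_Measure
  (@lebesgue_measure R \x mu)%E (@measurable_rV_cons n).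

HB.instance Definition _ := Measure.copy rV_cons_measure pfm.

Lemma rV_cons_measure_sigma_finite : sigma_finite setT rV_cons_measure.
Proof.
have [F FT Foo] : sigma_finite setT (@lebesgue_measure R \x mu)%E.
  exact: sigma_finite_product.
exists (fun i => @rV_uncons n @^-1` F i).
  by rewrite -preimage_bigcup -FT.
move=> i; have [mF Fi] := Foo i; split.
  by rewrite -[X in measurable X]setTI; exact: measurable_rV_uncons.
rewrite /rV_cons_measure /pushforward -comp_preimage.
rewrite (_ : _ \o _ = id) ?preimage_id//.
by apply/funext => z /=; rewrite rV_consK.
Qed.

HB.instance Definition _ := Measure_isSigmaFinite.Build _ _ _
  rV_cons_measure rV_cons_measure_sigma_finite.

End step.

Fixpoint lebesgue_rV n : {sigma_finite_measure set 'rV[R]_n -> \bar R} :=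
  match n with
  | 0 => \d_(0 : 'rV[R]_0)
  | m.+1 => rV_cons_measure (lebesgue_rV m)
  end.

Lemma lebesgue_rV_box n (A : 'I_n -> set R) : (forall i, measurable (A i)) ->
  lebesgue_rV n [set x | forall i, A i (x 0 i)] =
  (\prod_(i < n) @lebesgue_measure R (A i))%E.
Proof.
elim: n A => [|n IH] A mA.
  rewrite big_ord0 /= diracE mem_set//=; by case.
rewrite big_ord_recl -IH; last by move=> i; exact: mA.
have mB : measurable [set x : 'rV[R]_n | forall i, A (lift ord0 i) (x 0 i)].
  rewrite [X in measurable X](_ : _ = \bigcap_(i in [set: 'I_n])
      ((fun x : 'rV[R]_n => x 0 i) @^-1` A (lift ord0 i))).
    apply: fin_bigcap_measurable; first exact: finite_finset.
    move=> i _; rewrite -[X in measurable X]setTI.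
    by apply: measurable_rV_coor => //; exact: mA.
  by apply/seteqP; split => x /= h i; [move=> _; exact: h|exact: h].
rewrite -product_measure1E//; last exact: mA.
rewrite /= /rV_cons_measure /pushforward; congr (_ _).
apply/seteqP; split => -[a x] /=.
  move=> h; split; first by have := h ord0; rewrite rV_cons0.
  by move=> i; have := h (lift ord0 i); rewrite rV_consS.
move=> [h0 h] i; case: (unliftP ord0 i) => [j|] ->.
  by rewrite rV_consS; exact: h.
by rewrite rV_cons0.
Qed.

End rV_lebesgue.

Local Open Scope complex_scope.

Section functions.
Context {R : realType} (N : nat).
Local Notation E := 'rV[R]_N.
Local Notation mu := (@lebesgue_rV R N).
Implicit Types (f g u v : E -> R[i]) (psi : E -> R) (i : 'I_N) (q : R).

(* `|x| on 'rV[R]_N is the sup norm *)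
Definition enorm (x : E) : R := Num.sqrt (\sum_i x 0 i ^+ 2).

Definition cintegral f : R[i] :=
  (\int[mu]_(x in setT) complex.Re (f x))
  +i* (\int[mu]_(x in setT) complex.Im (f x)).

Definition inner u v : R[i] := cintegral (fun x => u x * conjc (v x)).

Definition cmeasurable f : Prop :=
  measurable_fun [set: E] (fun x => complex.Re (f x)) /\
  measurable_fun [set: E] (fun x => complex.Im (f x)).

Definition Lnormc q f : \bar R :=
  'N[mu]_(q%:E) [EFin \o (@ComplexField.Normc.normc R \o f)].

Definition memLp q f : Prop := cmeasurable f /\ (Lnormc q f < +oo)%E.

Definition partial i psi : E -> R := 'D_(delta_mx 0 i) psi.

Definition mpartial (s : seq 'I_N) psi : E -> R := foldr partial psi s.

Definition laplacian psi : E -> R := fun x => \sum_i mpartial [:: i; i] psi x.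

(* C^oo_c(R^N): the iterated partial derivatives of all orders exist and are
   continuous.  Real-valued test functions suffice: a distribution is
   complex linear. *)
Definition test_function psi : Prop :=
  (forall s : seq 'I_N, continuous (mpartial s psi) /\
     forall i x, derivable (mpartial s psi) x (delta_mx 0 i)) /\
  compact (closure [set x | psi x != 0]).

Definition weak_partial i f g : Prop :=
  forall psi, test_function psi ->
    cintegral (fun x => f x * (partial i psi x)%:C) =
    - cintegral (fun x => g x * (psi x)%:C).

Definition is_green (lambda : R) (G : E -> R[i]) : Prop :=
  memLp 2 G /\
  forall psi, test_function psi ->
    cintegral (fun x => G x * (lambda * psi x - laplacian psi x)%:C) =
    (psi 0)%:C.

End functions.

Definition euler_gamma (R : realType) : R :=
  limn (fun n => series (@harmonic R) n - ln n%:R).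

(* Only the values N = 2 and N = 3 are meaningful *)
Definition beta_coef {R : realType} (N : nat) (lambda : R) : R :=
  if N == 2%N then
    (pi *+ 2)^-1 * (euler_gamma R + ln (Num.sqrt lambda / 2))
  else Num.sqrt lambda / (pi *+ 4).

(* An element f + c G of X_0.  The charge c is uniquely determined by the
   function and f, grad f up to null sets, so functionals of the function may be
   defined from the decomposition; f being arbitrary in its class, every
   measurable representative of an element of X_0 is of this form. *)
Record X0 {R : realType} (N : nat) (p : R) (G : 'rV[R]_N -> R[i]) := {
  X0_reg : 'rV[R]_N -> R[i];
  X0_grad : 'I_N -> 'rV[R]_N -> R[i];
  X0_charge : R[i];
  X0_regP : memLp (p + 1) X0_reg;
  X0_gradP : forall i, weak_partial i X0_reg (X0_grad i) /\ memLp 2 (X0_grad i)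
}.

Definition X0_fun {R : realType} (N : nat) (p : R) (G : 'rV[R]_N -> R[i])
  (u : X0 p G) : 'rV[R]_N -> R[i] := fun x => X0_reg u x + X0_charge u * G x.

Coercion X0_fun : X0 >-> Funclass.

Definition delta_form {R : realType} (N : nat) (alpha p lambda : R)
    (G : 'rV[R]_N -> R[i]) (u v : X0 p G) : R[i] :=
  let c := X0_charge u in let d := X0_charge v in
  \sum_i inner (X0_grad u i) (X0_grad v i)
  + (alpha + beta_coef N lambda + lambda * fine (Lnormc 2 G) ^+ 2)%:C
    * c * conjc d
  - lambda%:C * conjc d * inner u G
  - lambda%:C * c * conjc (inner v G).

Definition A0 {R : realType} (N : nat) (alpha p lambda : R)
    (G : 'rV[R]_N -> R[i]) (phi : 'rV[R]_N -> R[i]) : Prop :=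
  ~ {ae @lebesgue_rV R N, forall x, phi x = 0} /\
  exists2 u : X0 p G, phi = u &
    forall w : X0 p G,
      delta_form alpha lambda u w
      + inner (fun x =>
          (ComplexField.Normc.normc (phi x) `^ (p - 1))%:C * phi x) w = 0.

Definition radial {R : realType} (N : nat) (phi : R -> R) :
  'rV[R]_N -> R[i] := fun x => (phi (enorm x))%:C.
Arguments radial {R} N phi x.

(* Main.v *)
(* Test functions vanishing near the origin do not see the charge, so phi0 is a
   distributional solution of Laplacian phi = phi^p away from 0.  Since phi0 is
   only known to be decreasing, it is replaced by averages V(r) of phi0 over the
   dilations by factors in [1 - e, 1 + e]: these are smooth, satisfy
   phi0((1 + e) r) <= V(r) <= phi0((1 - e) r), and the radial Laplacian of V lies
   between (1 - e) phi0((1 + e) r)^p and (1 + e) phi0((1 - e) r)^p, because the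
   Laplacian in r of the averaging kernel is, up to a factor close to 1, its
   Laplacian in x.  As phi0 tends to 0 at infinity, the maximum principle compares
   V with the sub- and supersolutions c r^-a and C r^-a, a = 2 / (p - 1), of the
   radial equation, and e -> 0 transfers the bounds to phi0; the subsolution uses
   a > N - 2.  Square integrability is then a geometric series over dyadic
   shells. *)
From HB Require Import structures.
Require Import Defs.
From mathcomp Require Import all_boot all_order all_algebra.
From mathcomp Require Import all_classical all_reals all_analysis.
From mathcomp Require Import measurable_realfun lebesgue_integral_under.
From mathcomp Require Import complex.
From mathcomp Require Import ring lra.
Set Implicit Arguments.
Unset Strict Implicit.
Unset Printing Implicit Defensive.

Import Order.TTheory GRing.Theory Num.Theory.
Import numFieldNormedType.Exports.
Local Open Scope classical_set_scope.
Local Open Scope ring_scope.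

(** * Decreasing solutions of the radial equation *)

(** Dilations are averaged, rather than translations, because they keep radial functions radial: for
    radial u, the radial Laplacian of r -> u(r y) is |y|^2 times the Laplacian of u at r y, and
    |y|^2 is the factor close to 1. All derivatives fall on the kernel, so neither elliptic
    regularity nor polar coordinates are needed. The obstacle is that [V r] is only squeezed between
    values of [phi0] at two other radii, and [phi0] may a priori jump between them, whereas the
    comparison needs the reverse estimates: [V r] not much above [phi0] at (1 + e) r, and not much
    below [phi0] at (1 - e) r. They follow from a bound on V' independent of e: the Laplacian of [V]
    is nonnegative, so r^(N-1) V' is nondecreasing, and a bounded function with this property has a
    bounded derivative on compact intervals. The barriers satisfy their differential inequalities
    with 1/2 and 2 in place of 1, which leaves room for the factors 1 - e and 1 + e. *)

Lemma le_powR (R : realType) (x y q : R) :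
  0 <= q -> 0 <= x -> x <= y -> x `^ q <= y `^ q.
Proof.
by move=> q0 x0 xy; apply: ge0_ler_powR; rewrite // nnegrE// (le_trans x0).
Qed.

Lemma powR_exprAC (R : realType) (x a : R) (n : nat) :
  0 <= x -> (x `^ a) ^+ n = (x ^+ n) `^ a.
Proof.
move=> x0; rewrite -(powR_mulrn n (powR_ge0 x a)) -(powR_mulrn n x0) -!powRrM.
by congr (_ `^ _); exact: mulrC.
Qed.

Lemma MVT_pos (R : realType) (f df : R -> R) (a b : R) :
  (forall x : R, 0 < x -> is_derive x 1 f (df x)) -> 0 < a -> a < b ->
  exists2 c, a < c < b & f b - f a = df c * (b - a).
Proof.
move=> dfE a0 ab.
have [||c] := @MVT R f df a b ab.
- by move=> x xab; apply: dfE; move: xab; rewrite in_itv/= => /andP[/(lt_trans a0)].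
- apply: continuous_in_subspaceT => x; rewrite inE/= in_itv/= => /andP[ax _].
  have [+ _] := dfE _ (lt_le_trans a0 ax).
  by move=> /derivable1_diffP /differentiable_continuous.
- by rewrite in_itv/= => cab ->; exists c.
Qed.

(** A positive derivative at the single point [c] is enough, so the second derivatives in the
    maximum principle need not be continuous. *)
Lemma is_derive_gt0_right (R : realType) (f : R -> R) (c d : R) :
  is_derive c 1 f d -> 0 < d ->
  exists2 h, 0 < h & forall x, c < x < c + h -> f c < f x.
Proof.
move=> [df fd] d0.
have : h^-1 *: (f (h + c) - f c) @[h --> 0^'] --> d.
  have -> : (fun h => h^-1 *: (f (h + c) - f c)) =
      (fun h => h^-1 *: (f (h *: (1 : R) + c) - f c)).
    by apply/funext => h; rewrite /GRing.scale/= mulr1.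
  by rewrite -fd; exact: df.
move=> /cvgrPdist_lt /(_ _ d0) [e/= e0 He].
exists e => // x /andP[cx xce].
have := He (x - c); rewrite /ball/= sub0r normrN gtr0_norm ?subr_gt0// ltrBlDl.
move=> /(_ xce); rewrite subr_eq0 gt_eqF// => /(_ isT); rewrite subrK.
move=> /(le_lt_trans (ler_norm _)); rewrite ltrBlDl -ltrBlDr subrr.
by rewrite pmulr_rgt0 ?invr_gt0 ?subr_gt0.
Qed.

Section radial_ode.
Context {R : realType} (k : nat).

(** Divergence form of the radial Laplacian in dimension k + 1: its sign becomes monotonicity of the
    flux r^k F'. *)
Lemma is_derive_radial_flux (F1 F2 : R -> R) (r : R) : 0 < r ->
  is_derive r 1 F1 (F2 r) ->
  is_derive r 1 (fun r => r ^+ k * F1 r) (r ^+ k * (F2 r + k%:R / r * F1 r)).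
Proof.
move=> r0 dF1.
rewrite (_ : (fun r => r ^+ k * F1 r) = (id : R -> R) ^+ k * F1); last first.
  by apply/funext => x; rewrite fctE/= exprfctE.
apply: is_derive_eq; rewrite /GRing.scale/= exprfctE mulr1.
case: k => [|j]; first by rewrite !mul0r mulr0 !addr0.
rewrite /= mulrDr; congr (_ + _); rewrite exprS -mulr_natr; field.
exact: lt0r_neq0.
Qed.

(** At a positive interior maximum [c] the flux vanishes and has positive derivative, so F' > 0 just
    to the right of [c], and the mean value theorem produces a value above the maximum. *)
Lemma radial_max_principle (F F1 F2 : R -> R) (a b : R) : 0 < a -> a < b ->
  (forall r : R, 0 < r -> is_derive r 1 F (F1 r)) ->
  (forall r : R, 0 < r -> is_derive r 1 F1 (F2 r)) ->
  F a <= 0 -> F b <= 0 ->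
  (forall r, a < r < b -> 0 < F r -> 0 < F2 r + k%:R / r * F1 r) ->
  forall r, a <= r <= b -> F r <= 0.
Proof.
move=> a0 ab dF dF1 Fa Fb LF r rab.
have [|c] := @EVT_max R F a b (ltW ab).
  apply: continuous_in_subspaceT => x; rewrite inE/= in_itv/= => /andP[ax _].
  have [+ _] := dF _ (lt_le_trans a0 ax).
  by move=> /derivable1_diffP /differentiable_continuous.
rewrite in_itv/= => /andP[ac cb] cmax.
apply: (le_trans (cmax r _)); first by rewrite in_itv.
rewrite leNgt; apply/negP => Fc.
have {}ac : a < c by rewrite lt_neqAle ac andbT; apply: contraL Fc => /eqP <-; rewrite -leNgt.
have {}cb : c < b by rewrite lt_neqAle cb andbT; apply: contraL Fc => /eqP ->; rewrite -leNgt.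
have c0 := lt_trans a0 ac.
have F1c : F1 c = 0.
  have [] := @derive1_at_max R F a b c (ltW ab) _ _ _.
  - move=> t; rewrite in_itv/= => /andP[at_ _].
    by have [] := dF _ (lt_trans a0 at_).
  - by rewrite in_itv/= ac.
  - by move=> t; rewrite in_itv/= => /andP[at_ tb]; apply: cmax; rewrite in_itv/= !ltW.
  by move=> _ <-; have [_ ->] := dF _ c0.
have Q := @is_derive_radial_flux F1 F2 c c0 (dF1 _ c0).
have [|h h0 hQ] := is_derive_gt0_right Q.
  by rewrite mulr_gt0 ?exprn_gt0// LF ?ac.
pose y := Num.min b (c + h / 2).
have cy : c < y by rewrite lt_min cb ltrDl divr_gt0.
have yb : y <= b by rewrite ge_min lexx.
have yh : y < c + h by rewrite gt_min; apply/orP; right; rewrite ltrD2l; lra.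
have [z /andP[cz zy]] := MVT_pos dF c0 cy.
have : F1 z > 0.
  have := hQ z; rewrite cz (lt_trans zy yh) F1c mulr0 => /(_ isT).
  by rewrite pmulr_rgt0// exprn_gt0// (lt_trans c0).
move=> F1z /eqP; apply/negP; rewrite lt_eqF//.
apply: (@le_lt_trans _ _ 0); last by rewrite mulr_gt0// subr_gt0.
by rewrite subr_le0; apply: cmax; rewrite in_itv/= yb ltW// (lt_trans ac).
Qed.

Variables (p : R) (phi : R -> R).

(* [V] is [phi] averaged over dilations by factors in [[1 - e, 1 + e]]. *)
Definition mollified (e : R) (V V1 V2 : R -> R) : Prop :=
  [/\ forall r : R, 0 < r -> is_derive r 1 V (V1 r),
      forall r : R, 0 < r -> is_derive r 1 V1 (V2 r),
      forall r, 0 < r -> phi ((1 + e) * r) <= V r <= phi ((1 - e) * r) &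
      forall r, 0 < r -> (1 - e) * phi ((1 + e) * r) `^ p <=
        V2 r + k%:R / r * V1 r <= (1 + e) * phi ((1 - e) * r) `^ p].

Hypothesis phi_gt0 : forall r, 0 < r -> 0 < phi r.
Hypothesis phi_decr : forall r s, 0 < r -> r <= s -> phi s <= phi r.

(** The point is that [K] does not depend on [e]. On [a/2, 2b] the function [V] lies between 0 and
    [phi (a / 4)], so its mean slopes over [a/2, r] and [r, 2b] are bounded; since r^k V' is
    nondecreasing, the slope attained to the left of r bounds V'(r) from below and the one attained
    to the right bounds it from above. *)
Lemma mollified_gradient_bound (a b : R) : 0 < a -> a < b ->
  exists2 K, 0 < K & forall e V V1 V2, 0 < e <= 4^-1 -> mollified e V V1 V2 ->
    forall r, a <= r <= b -> `|V1 r| <= K.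
Proof.
move=> a0 ab; have b0 := lt_trans a0 ab.
have M0 : 0 < phi (a / 4) by apply: phi_gt0; rewrite divr_gt0.
exists ((2 * b / a) ^+ k * (phi (a / 4) / b) + 2 * phi (a / 4) / a).
  by rewrite addr_gt0// !mulr_gt0// ?exprn_gt0 ?mulr_gt0 ?invr_gt0.
move=> e V V1 V2 /andP[e0 e4] [dV dV1 Vphi LV] r /andP[ar rb].
have r0 : 0 < r by exact: lt_le_trans ar.
have VM s : a / 2 <= s -> 0 <= V s <= phi (a / 4).
  move=> as_; have s0 : 0 < s by apply: lt_le_trans as_; rewrite divr_gt0.
  have /andP[V1s V2s] := Vphi _ s0; apply/andP; split.
    by apply: le_trans V1s; rewrite ltW// phi_gt0// mulr_gt0// addr_gt0.
  by apply: (le_trans V2s); apply: phi_decr; [rewrite divr_gt0|nra].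
have Qmon s t : 0 < s -> s < t -> s ^+ k * V1 s <= t ^+ k * V1 t.
  move=> s0 st.
  have [x x0|x /andP[sx _]] := @MVT_pos _ (fun r => r ^+ k * V1 r)
      (fun r => r ^+ k * (V2 r + k%:R / r * V1 r)) s t _ s0 st.
    exact: (@is_derive_radial_flux _ V2 _ _ (dV1 x x0)).
  have x0 := lt_trans s0 sx.
  rewrite -subr_ge0 => ->; rewrite mulr_ge0 ?subr_ge0//; last exact: ltW.
  rewrite mulr_ge0 ?exprn_ge0//; first exact: ltW.
  have /andP[+ _] := LV _ x0; apply: le_trans.
  by rewrite mulr_ge0 ?powR_ge0//; lra.
rewrite ler_norml; apply/andP; split.
- have a2 : 0 < a / 2 by rewrite divr_gt0.
  have a2r : a / 2 < r by lra.
  have [x /andP[ax xr] Vx] := MVT_pos dV a2 a2r.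
  have x0 := lt_trans a2 ax.
  have xk : (x / r) ^+ k <= 1.
    rewrite exprn_ile1//; first by rewrite divr_ge0 ?ltW.
    by rewrite ler_pdivrMr// mul1r ltW.
  have V1r : (x / r) ^+ k * V1 x <= V1 r.
    rewrite expr_div_n mulrAC ler_pdivrMr ?exprn_gt0// [V1 r * _]mulrC.
    exact: Qmon.
  have V1x : - (2 * phi (a / 4) / a) <= V1 x.
    have /andP[? ?] := VM (a / 2) (lexx _); have /andP[? ?] := VM r (ltW a2r).
    rewrite -(ler_pM2r (_ : 0 < r - a / 2)) ?subr_gt0// -Vx mulNr.
    apply: (@le_trans _ _ (- phi (a / 4))); last by lra.
    rewrite lerN2 mulrAC ler_pdivlMr// [_ * a]mulrC mulrAC.
    by rewrite ler_wpM2r ?(ltW M0)//; lra.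
  have K1 : 0 <= (2 * b / a) ^+ k * (phi (a / 4) / b).
    by rewrite mulr_ge0 ?exprn_ge0 ?divr_ge0 ?mulr_ge0 ?(ltW a0) ?(ltW b0) ?(ltW M0).
  have xk0 : 0 <= (x / r) ^+ k by rewrite exprn_ge0 ?divr_ge0 ?(ltW x0) ?(ltW r0).
  have K2 : 0 <= 2 * phi (a / 4) / a by rewrite !mulr_ge0 ?invr_ge0 ?(ltW a0) ?(ltW M0).
  apply: le_trans V1r; nra.
- have r2b : r < 2 * b by lra.
  have [x /andP[rx xb] Vx] := MVT_pos dV r0 r2b.
  have x0 := lt_trans r0 rx.
  have xk : (x / r) ^+ k <= (2 * b / a) ^+ k.
    rewrite lerXn2r ?nnegrE ?divr_ge0 ?mulr_ge0 ?(ltW x0) ?(ltW r0) ?(ltW b0) ?(ltW a0)//.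
    by rewrite ler_pM ?invr_ge0 ?(ltW x0) ?(ltW r0) ?(ltW xb)// lef_pV2 ?posrE.
  have V1r : V1 r <= (x / r) ^+ k * V1 x.
    rewrite expr_div_n mulrAC ler_pdivlMr ?exprn_gt0// [V1 r * _]mulrC.
    exact: Qmon.
  have V1x : V1 x <= phi (a / 4) / b.
    have ar2 : a / 2 <= r by lra.
    have ab2 : a / 2 <= 2 * b by lra.
    have /andP[? ?] := VM _ ar2; have /andP[? ?] := VM _ ab2.
    rewrite -(ler_pM2r (_ : 0 < 2 * b - r)) ?subr_gt0// -Vx.
    apply: (@le_trans _ _ (phi (a / 4))); first by lra.
    rewrite mulrAC ler_pdivlMr//.
    by rewrite ler_wpM2l ?(ltW M0)//; lra.
  have K2 : 0 <= 2 * phi (a / 4) / a by rewrite !mulr_ge0 ?invr_ge0 ?(ltW a0) ?(ltW M0).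
  have xk0 : 0 <= (x / r) ^+ k by rewrite exprn_ge0 ?divr_ge0 ?(ltW x0) ?(ltW r0).
  have Mb : 0 <= phi (a / 4) / b by rewrite divr_ge0 ?(ltW b0) ?(ltW M0).
  apply: (le_trans V1r); nra.
Qed.

(** These inequalities are reverse to those in [mollified]. Choosing s with (1 + e) s = (1 - e) r,
    or with the signs exchanged, makes [V s] comparable with the wanted value of [phi]; the
    Lipschitz bound, uniform in [e], then moves from s to r. *)
Lemma mollified_approx (a b eta : R) : 0 < a -> a < b -> 0 < eta ->
  exists2 e0, 0 < e0 <= 4^-1 & forall e V V1 V2, 0 < e <= e0 ->
    mollified e V V1 V2 -> forall r, a <= r <= b ->
      phi ((1 - e) * r) <= V r + eta /\ V r - eta <= phi ((1 + e) * r).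
Proof.
move=> a0 ab eta0; have b0 := lt_trans a0 ab.
have a2 : 0 < a / 2 by rewrite divr_gt0.
have a2b : a / 2 < 2 * b by lra.
have [K K0 HK] := mollified_gradient_bound a2 a2b.
(* The points r and s differ by at most 4 e b, so [V] changes by at most 4 e b K, which this choice
   keeps below [eta]. *)
pose e0 := Num.min 4^-1 (eta / (4 * K * b)).
have Kb0 : 0 < 4 * K * b by rewrite !mulr_gt0.
exists e0; first by rewrite lt_min invr_gt0 ltr0n divr_gt0//= ge_min lexx.
move=> e V V1 V2 /andP[e_gt0]; rewrite le_min => /andP[e4 eeta] mV r /andP[ar rb].
have eKb : 4 * e * b * K <= eta.
  by move: eeta; rewrite ler_pdivlMr// => /(le_trans _); apply; rewrite le_eqVlt; apply/orP; left; apply/eqP; ring.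
have r0 : 0 < r by exact: lt_le_trans ar.
have {}HK := HK e V V1 V2 _ mV; have {HK} HK x : a / 2 <= x <= 2 * b -> `|V1 x| <= K.
  by apply: HK; rewrite e_gt0.
have [dV dV1 Vphi LV] := mV.
have lip x y : a / 2 <= x -> x < y -> y <= 2 * b -> `|V y - V x| <= K * (y - x).
  move=> ax xy yb; have x0 := lt_le_trans a2 ax.
  have [z /andP[xz zy] ->] := MVT_pos dV x0 xy.
  rewrite normrM (gtr0_norm (_ : 0 < y - x)) ?subr_gt0//.
  rewrite ler_wpM2r ?subr_ge0 ?(ltW xy)//; apply: HK.
  by rewrite (le_trans ax (ltW xz)) (le_trans (ltW zy) yb).
have e1 : 0 < 1 + e by lra.
have e1' : 0 < 1 - e by lra.
split.
- pose s := (1 - e) / (1 + e) * r.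
  have sr : (1 + e) * s = (1 - e) * r by rewrite /s; field; exact: lt0r_neq0.
  have sr' : s < r by nra.
  have rs2 : r <= 2 * s by nra.
  have s0 : 0 < s by lra.
  have /andP[+ _] := Vphi s s0; rewrite sr => /le_trans; apply.
  have as2 : a / 2 <= s by lra.
  have r2b : r <= 2 * b by lra.
  have := lip s r as2 sr' r2b; rewrite ler_norml => /andP[+ _].
  have : K * (r - s) <= 4 * e * b * K.
    rewrite mulrC ler_pM2r//; nra.
  lra.
- pose s := (1 + e) / (1 - e) * r.
  have sr : (1 - e) * s = (1 + e) * r by rewrite /s; field; exact: lt0r_neq0.
  have sr' : r < s by nra.
  have rs2 : s <= 2 * r by nra.
  have s0 : 0 < s by lra.
  have /andP[_ +] := Vphi s s0; rewrite sr; apply: le_trans.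
  have as2 : a / 2 <= r by lra.
  have r2b : s <= 2 * b by lra.
  have := lip r s as2 sr' r2b; rewrite ler_norml => /andP[+ _].
  have : K * (s - r) <= 4 * e * b * K.
    rewrite mulrC ler_pM2r//; nra.
  lra.
Qed.

Hypothesis p1 : 1 < p.
Hypothesis mollifications : forall e : R, 0 < e <= 4^-1 ->
  exists V V1 V2, mollified e V V1 V2.

Variables (W W1 W2 : R -> R).
Hypothesis W_gt0 : forall r, 0 < r -> 0 < W r.
Hypothesis dW : forall r : R, 0 < r -> is_derive r 1 W (W1 r).
Hypothesis dW1 : forall r : R, 0 < r -> is_derive r 1 W1 (W2 r).

(** Where V > W + kap, the approximation gives W <= phi at (1 + e) r, so the Laplacian of [V] is at
    least (1 - e) W^p >= (3/4) W^p, more than that of [W]. The maximum principle thus applies to V -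
    W - kap. *)
Lemma supersolution_ge :
  (forall r, 0 < r -> W2 r + k%:R / r * W1 r <= 2^-1 * W r `^ p) ->
  (forall r, 1 <= r <= 2 -> phi 1 <= W r) ->
  (forall e, 0 < e -> exists2 b, 0 < b & phi b < e) ->
  forall r, 1 <= r -> phi r <= W r.
Proof.
move=> LW W12 phi0 r1 r1_ge1; rewrite leNgt; apply/negP => Wphi.
have r12 : 2 < r1.
  rewrite ltNge; apply/negP => r12; move: Wphi; apply/negP; rewrite -leNgt.
  by apply: le_trans (W12 r1 _); [exact: phi_decr|rewrite r1_ge1].
(* Half of the supposed gap at [r1]: the comparison loses [kap] and the approximation kap / 2, in
   total less than the gap. *)
pose kap := (phi r1 - W r1) / 2.
have kap0 : 0 < kap by rewrite divr_gt0// subr_gt0.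
have [b' b'0 phib'] := phi0 _ kap0.
pose b := Num.max (2 * b') (r1 + 1).
have b'b : 2 * b' <= b by rewrite le_max lexx.
have r1b : r1 < b by rewrite lt_max [X in _ || X]ltrDl ltr01 orbT.
(* The comparison starts at 3/2, so that the averages at the left end only involve radii at least
   9/8, where [phi] is at most [phi 1]. *)
have a0 : (0 : R) < 3 / 2 by lra.
have ab : 3 / 2 < b by lra.
have kap2 : 0 < kap / 2 by lra.
have [e /andP[e0 e4] approx] := mollified_approx a0 ab kap2.
have [V [V1 [V2 mV]]] : exists V V1 V2, mollified e V V1 V2.
  by apply: mollifications; rewrite e0.
have {}approx := approx e V V1 V2 _ mV.
have {}approx : forall r, 3 / 2 <= r <= b ->
    phi ((1 - e) * r) <= V r + kap / 2 /\ V r - kap / 2 <= phi ((1 + e) * r).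
  by apply: approx; rewrite e0 lexx.
have [dV dV1 Vphi LV] := mV.
have := @radial_max_principle (V - (W + cst kap)) (V1 - W1) (V2 - W2) (3 / 2) b a0 ab.
have dF (r : R) : 0 < r -> is_derive r 1 (V - (W + cst kap)) ((V1 - W1) r).
  by move=> r0; have := dV _ r0; have := dW r0 => ? ?; apply: is_derive_eq; rewrite addr0.
have dF1 (r : R) : 0 < r -> is_derive r 1 (V1 - W1) ((V2 - W2) r).
  by move=> r0; have := dV1 _ r0; have := dW1 r0 => ? ?; apply: is_derive_eq.
move=> /(_ dF dF1).
have FE r : (V - (W + cst kap)) r = V r - (W r + kap) by [].
have Fa : (V - (W + cst kap)) (3 / 2) <= 0.
  rewrite FE.
  have W32 : phi 1 <= W (3 / 2) by apply: W12; apply/andP; split; lra.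
  have /andP[_ V32] := Vphi _ a0.
  have : phi ((1 - e) * (3 / 2)) <= phi 1 by apply: phi_decr => //; lra.
  lra.
have Fb : (V - (W + cst kap)) b <= 0.
  rewrite FE; have b0 : 0 < b by lra.
  have /andP[_ Vb] := Vphi _ b0; have := W_gt0 b0.
  have : phi ((1 - e) * b) <= phi b' by apply: phi_decr => //; nra.
  lra.
move=> /(_ Fa Fb) max_F.
have : (V - (W + cst kap)) r1 <= 0.
  apply: max_F; last by apply/andP; split; lra.
  move=> r /andP[ar rb]; rewrite FE subr_gt0 => WV.
  have r0 : 0 < r by lra.
  have /approx [_ Vr] : 3 / 2 <= r <= b by rewrite !ltW.
  have /andP[LV1 _] := LV _ r0; have := LW _ r0.
  have Wr := W_gt0 r0.
  have : W r `^ p <= phi ((1 + e) * r) `^ p.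
    have Wphi_r : W r <= phi ((1 + e) * r) by lra.
    apply: le_powR; rewrite ?(ltW Wr)//.
    exact: ltW (lt_trans ltr01 p1).
  have : 0 < W r `^ p by rewrite powR_gt0.
  rewrite !fctE; nra.
have /approx [+ _] : 3 / 2 <= r1 <= b by apply/andP; split; lra.
rewrite FE.
have : phi r1 <= phi ((1 - e) * r1) by apply: phi_decr; nra.
rewrite /kap; lra.
Qed.

(** The argument for the supersolution with [V] and [W] exchanged: now 2 exceeds 1 + e <= 5/4, the
    radii averaged at 3/2 stay below 15/8 < 2, and at the outer end it is [W] that must be small. *)
Lemma subsolution_le :
  (forall r, 0 < r -> 2 * W r `^ p <= W2 r + k%:R / r * W1 r) ->
  (forall r, 1 <= r <= 2 -> W r <= phi 2) ->
  (forall e, 0 < e -> exists b0, forall b, b0 <= b -> W b < e) ->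
  forall r, 1 <= r -> W r <= phi r.
Proof.
move=> LW W12 Wy r1 r1_ge1; rewrite leNgt; apply/negP => Wphi.
have r12 : 2 < r1.
  rewrite ltNge; apply/negP => r12; move: Wphi; apply/negP; rewrite -leNgt.
  apply: (le_trans (W12 r1 _)); first by rewrite r1_ge1.
  by apply: phi_decr => //; lra.
pose kap := (W r1 - phi r1) / 2.
have kap0 : 0 < kap by rewrite divr_gt0// subr_gt0.
have [b' Wb'] := Wy _ kap0.
pose b := Num.max b' (r1 + 1).
have b'b : b' <= b by rewrite le_max lexx.
have r1b : r1 < b by rewrite lt_max [X in _ || X]ltrDl ltr01 orbT.
have a0 : (0 : R) < 3 / 2 by lra.
have ab : 3 / 2 < b by lra.
have kap2 : 0 < kap / 2 by lra.
have [e /andP[e0 e4] approx] := mollified_approx a0 ab kap2.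
have [V [V1 [V2 mV]]] : exists V V1 V2, mollified e V V1 V2.
  by apply: mollifications; rewrite e0.
have {}approx := approx e V V1 V2 _ mV.
have {}approx : forall r, 3 / 2 <= r <= b ->
    phi ((1 - e) * r) <= V r + kap / 2 /\ V r - kap / 2 <= phi ((1 + e) * r).
  by apply: approx; rewrite e0 lexx.
have [dV dV1 Vphi LV] := mV.
have := @radial_max_principle (W - (V + cst kap)) (W1 - V1) (W2 - V2) (3 / 2) b a0 ab.
have dF (r : R) : 0 < r -> is_derive r 1 (W - (V + cst kap)) ((W1 - V1) r).
  by move=> r0; have := dV _ r0; have := dW r0 => ? ?; apply: is_derive_eq; rewrite addr0.
have dF1 (r : R) : 0 < r -> is_derive r 1 (W1 - V1) ((W2 - V2) r).
  by move=> r0; have := dV1 _ r0; have := dW1 r0 => ? ?; apply: is_derive_eq.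
move=> /(_ dF dF1).
have FE r : (W - (V + cst kap)) r = W r - (V r + kap) by [].
have Fa : (W - (V + cst kap)) (3 / 2) <= 0.
  rewrite FE.
  have W32 : W (3 / 2) <= phi 2 by apply: W12; apply/andP; split; lra.
  have /andP[V32 _] := Vphi _ a0.
  have : phi 2 <= phi ((1 + e) * (3 / 2)) by apply: phi_decr => //; lra.
  lra.
have Fb : (W - (V + cst kap)) b <= 0.
  rewrite FE; have b0 : 0 < b by lra.
  have /andP[Vb _] := Vphi _ b0; have := Wb' _ b'b.
  have : 0 < phi ((1 + e) * b) by apply: phi_gt0 => //; nra.
  lra.
move=> /(_ Fa Fb) max_F.
have : (W - (V + cst kap)) r1 <= 0.
  apply: max_F; last by apply/andP; split; lra.
  move=> r /andP[ar rb]; rewrite FE subr_gt0 => WV.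
  have r0 : 0 < r by lra.
  have /approx [Vr _] : 3 / 2 <= r <= b by rewrite !ltW.
  have /andP[_ LV1] := LV _ r0; have := LW _ r0.
  have Wr := W_gt0 r0.
  have phi_r : 0 < phi ((1 - e) * r) by apply: phi_gt0; nra.
  have : phi ((1 - e) * r) `^ p <= W r `^ p.
    have Wphi_r : phi ((1 - e) * r) <= W r by lra.
    apply: le_powR; rewrite ?(ltW phi_r)//.
    exact: ltW (lt_trans ltr01 p1).
  have : 0 < W r `^ p by rewrite powR_gt0.
  rewrite !fctE; nra.
have /approx [_ +] : 3 / 2 <= r1 <= b by apply/andP; split; lra.
rewrite FE.
have : phi ((1 + e) * r1) <= phi r1 by apply: phi_decr; nra.
rewrite /kap; lra.
Qed.

End radial_ode.

(** * Powers of r as barriers *)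

Lemma is_derive_powRN (R : realType) (C a r : R) : 0 < r ->
  is_derive r 1 (fun r => C * r `^ (- a)) (- (C * a) * r `^ (- (a + 1))).
Proof.
move=> r0; have := is_derive1_powR (- a) r0 => ?.
rewrite (_ : (fun r => C * r `^ (- a)) = (C *: (@powR R ^~ (- a))))//.
by apply: is_derive_eq; rewrite /GRing.scale/= opprD mulrA mulrN.
Qed.

(** For W = C r^-a with a = 2 / (p - 1) one has a p = a + 2, so the Laplacian C A r^-(a+2) and W^p =
    C^p r^-(a+2) carry the same power of r. The barrier inequalities become 2 A <= C^(p-1) and
    c^(p-1) <= A / 2; the assumption on [k] says that A > 0. *)
Lemma two_sided_power_bound (R : realType) (k : nat) (p : R) (phi : R -> R) :
  1 < p ->
  (forall r, 0 < r -> 0 < phi r) ->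
  (forall r s, 0 < r -> r <= s -> phi s <= phi r) ->
  (forall e, 0 < e -> exists2 b, 0 < b & phi b < e) ->
  (forall e : R, 0 < e <= 4^-1 -> exists V V1 V2, mollified k p phi e V V1 V2) ->
  k%:R < 2 / (p - 1) + 1 ->
  exists c C : R, [/\ 0 < c, 0 < C &
    forall r, 1 <= r ->
      c * r `^ (- (2 / (p - 1))) <= phi r <= C * r `^ (- (2 / (p - 1)))].
Proof.
move=> p1 phi_gt0 phi_decr phi0 moll ka.
have q0 : 0 < p - 1 by rewrite subr_gt0.
set a := 2 / (p - 1) in ka *.
have a0 : 0 < a by rewrite divr_gt0.
have ap : a * p = a + 2 by rewrite /a; field; exact: lt0r_neq0.
pose A := a * (a + 1 - k%:R).
have A0 : 0 < A by rewrite mulr_gt0// subr_gt0.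
have A2 : 0 < 2 * A by rewrite mulr_gt0.
have A2' : 0 < A / 2 by rewrite divr_gt0.
pose W C r := C * r `^ (- a).
pose W1 C r := - (C * a) * r `^ (- (a + 1)).
pose W2 C r := - (- (C * a) * (a + 1)) * r `^ (- (a + 1 + 1)).
have W_gt0 C : 0 < C -> forall r, 0 < r -> 0 < W C r.
  by move=> C0 r r0; rewrite mulr_gt0// powR_gt0.
have dW C (r : R) : 0 < r -> is_derive r 1 (W C) (W1 C r).
  exact: is_derive_powRN.
have dW1 C (r : R) : 0 < r -> is_derive r 1 (W1 C) (W2 C r).
  exact: is_derive_powRN.
have LW C r : 0 < r -> W2 C r + k%:R / r * W1 C r = C * A * r `^ (- (a + 2)).
  move=> r0; rewrite /W2 /W1 /A.
  have -> : - (a + 1) = - (a + 2) + 1 by ring.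
  have -> : a + 1 + 1 = a + 2 by ring.
  by rewrite powRD ?(gt_eqF r0) ?implybT// powRr1 ?ltW//; field; exact: lt0r_neq0.
have Wp C r : 0 < C -> 0 < r -> W C r `^ p = C * C `^ (p - 1) * r `^ (- (a + 2)).
  move=> C0 r0; rewrite powRM ?powR_ge0 ?ltW// -powRrM mulNr ap; congr (_ * _).
  by rewrite mulr_powRB1 ?(ltW C0)// (lt_trans ltr01).
have rootK x : 0 < x -> (x `^ (p - 1)^-1) `^ (p - 1) = x.
  by move=> x0; rewrite -powRrM mulVf ?lt0r_neq0// powRr1// ltW.
clearbody A.
have upper : exists2 C, 0 < C & forall r, 1 <= r -> phi r <= W C r.
  (* The first entry gives C r^-a >= phi 1 on [1, 2], the second the supersolution inequality. *)
  pose C := Num.max (2 `^ a * phi 1) ((2 * A) `^ (p - 1)^-1).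
  have C0 : 0 < C by rewrite lt_max powR_gt0 ?orbT// mulr_gt0.
  exists C => //.
  apply: (supersolution_ge phi_gt0 phi_decr p1 moll (W_gt0 C C0) (dW C) (dW1 C)) => //.
  - move=> r r0; rewrite LW// Wp//.
    have : 2 * A <= C `^ (p - 1).
      have CA : (2 * A) `^ (p - 1)^-1 <= C by rewrite le_max lexx orbT.
      by apply: (le_trans _ (le_powR (ltW q0) (powR_ge0 _ _) CA)); rewrite rootK.
    have : 0 < r `^ (- (a + 2)) by rewrite powR_gt0.
    move=> ra; rewrite -subr_ge0 => CA.
    have := mulr_ge0 (mulr_ge0 (ltW C0) (ltW ra)) CA; lra.
  - move=> r /andP[r1 r2]; rewrite /W powRN ler_pdivlMr ?powR_gt0//; last lra.
    apply: (@le_trans _ _ (2 `^ a * phi 1)); last by rewrite le_max lexx.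
    rewrite mulrC ler_wpM2r//; first by rewrite ltW// phi_gt0.
    by apply: le_powR; rewrite ?(ltW a0)//; lra.
have lower : exists2 c, 0 < c & forall r, 1 <= r -> W c r <= phi r.
  (* The first entry suffices on [1, 2] because r^-a <= 1 there; the second gives the subsolution
     inequality. *)
  pose c := Num.min (phi 2) ((A / 2) `^ (p - 1)^-1).
  have c0 : 0 < c by rewrite lt_min phi_gt0//= powR_gt0// divr_gt0.
  exists c => //.
  apply: (subsolution_le phi_gt0 phi_decr p1 moll (W_gt0 c c0) (dW c) (dW1 c)) => //.
  - move=> r r0; rewrite LW// Wp//.
    have : c `^ (p - 1) <= A / 2.
      have cA : c <= (A / 2) `^ (p - 1)^-1 by rewrite ge_min lexx orbT.
      by apply: (le_trans (le_powR (ltW q0) (ltW c0) cA)); rewrite rootK.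
    have : 0 < r `^ (- (a + 2)) by rewrite powR_gt0.
    move=> ra; rewrite -subr_ge0 => CA.
    have := mulr_ge0 (mulr_ge0 (ltW c0) (ltW ra)) CA; lra.
  - move=> r /andP[r1 r2]; apply: (@le_trans _ _ c); last by rewrite ge_min lexx.
    rewrite /W powRN ler_pdivrMr ?powR_gt0//; last lra.
    rewrite ler_peMr ?(ltW c0)//.
    by rewrite -[leLHS](powRr0 r) ler_powR// ltW.
  - move=> e e0; exists ((c / e) `^ a^-1 + 1) => b bge.
    have b0 : 0 < b by apply: lt_le_trans bge; rewrite ltr_wpDl// powR_ge0.
    rewrite /W powRN ltr_pdivrMr ?powR_gt0// mulrC -ltr_pdivrMr//.
    have ce : 0 < c / e by rewrite divr_gt0.
    rewrite -[ltLHS]powRr1 ?(ltW ce)// -[X in _ `^ X](mulVf (lt0r_neq0 a0)) powRrM.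
    apply: gt0_ltr_powR; rewrite ?nnegrE ?powR_ge0 ?(ltW b0)//.
    by apply: lt_le_trans bge; rewrite ltrDl.
have [c c0 Hc] := lower; have [C C0 HC] := upper.
by exists c, C; split=> // r r1; rewrite Hc// HC.
Qed.

(** * Smooth functions *)

Section smooth_functions.
Context {R : realType}.

(** The classical flat function exp(-1/x), with a polynomial factor in 1/x that makes the family
    closed under differentiation. *)
Definition flat (q : {poly R}) (x : R) : R :=
  if 0 < x then q.[x^-1] * expR (- x^-1) else 0.

(** The power [k] is there for the induction: a factor X of the polynomial is absorbed into k +
    1. *)
Lemma poly_le_expR (q : {poly R}) (k : nat) :
  exists2 C, 0 <= C & forall y, 1 <= y -> `|q.[y]| * y ^+ k <= C * expR y.
Proof.
elim/poly_ind: q k => [|q c IH] k.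
  by exists 0 => // y _; rewrite horner0 normr0 !mul0r.
have [C C0 HC] := IH k.+1.
exists (C + `|c| * (k.+1)`!%:R) => [|y y1]; first by rewrite addr_ge0 ?mulr_ge0.
have y0 : 0 <= y by rewrite (le_trans _ y1).
have yk : y ^+ k <= (k.+1)`!%:R * expR y.
  have := expR_ge1Dxn k y0 => h.
  have k0 : 0 < (k.+1)`!%:R :> R by rewrite ltr0n fact_gt0.
  have : y ^+ k.+1 / (k.+1)`!%:R <= expR y by rewrite (le_trans _ h)// lerDr.
  by rewrite ler_pdivrMr// mulrC => /(le_trans _); apply; rewrite ler_weXn2l.
rewrite hornerMXaddC (le_trans (ler_wpM2r _ (ler_normD _ _))) ?exprn_ge0//.
rewrite mulrDl [leRHS]mulrDl lerD//.
  by rewrite normrM (ger0_norm y0) -mulrA -exprS; exact: HC.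
by rewrite -mulrA ler_wpM2l.
Qed.

Lemma flat_le (q : {poly R}) :
  exists2 C, 0 <= C & forall x, 0 < x -> x < 1 -> `|flat q x| <= C * x ^+ 2.
Proof.
have [C C0 HC] := poly_le_expR q 2; exists C => // x x0 x1.
rewrite /flat x0 normrM (ger0_norm (expR_ge0 _)) expRN ler_pdivrMr ?expR_gt0//.
rewrite mulrAC -ler_pdivrMr ?exprn_gt0// -exprVn; apply: HC.
by rewrite invf_ge1// ltW.
Qed.


Lemma is_derive_flat (q : {poly R}) (x : R) :
  is_derive x 1 (flat q) (flat ('X^2 * (q - q^`())) x).
Proof.
case: (ltgtP 0 x) => [x0|x0|<-].
- have flatE : \forall y \near x, q.[y^-1] * expR (- y^-1) = flat q y.
    near=> y; rewrite /flat ifT//; near: y; exact: lt_nbhsr.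
  apply: (near_eq_is_derive flatE).
  have xn0 := lt0r_neq0 x0.
  have dV : is_derive x 1 (fun y : R => y^-1) (- x ^- 2).
    split; first exact: derivableV.
    by rewrite deriveV// derive_id /GRing.scale/= mulr1.
  have := is_derive1_comp (is_derive_poly q x^-1) dV.
  have := @is_derive1_comp R expR (fun y => - y^-1) x _ _ (is_derive_expR _) (is_deriveN dV) => d1 d2.
  apply: (is_derive_eq (is_deriveM d2 d1)).
  by rewrite /flat x0 /GRing.scale/= !hornerE/=; field.
- have flatE : \forall y \near x, cst 0 y = flat q y.
    near=> y; rewrite /flat ifF//; apply/negbTE; rewrite -leNgt ltW//.
    by near: y; exact: lt_nbhsl.
  apply: (near_eq_is_derive flatE).
  by rewrite /flat (le_gtF (ltW x0)); exact: is_derive_cst.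
(* At the origin the difference quotient is 0 for h <= 0 and at most C h for 0 < h < 1. *)
- rewrite {2}/flat ltxx.
  have [C C0 HC] := flat_le q.
  suff cv : h^-1 *: ((flat q \o shift 0) (h *: (1 : R)) - flat q 0) @[h --> 0^'] --> (0 : R).
    by split; [apply/cvg_ex; exists 0|exact: cvg_lim].
  apply/cvgrPdist_le => e e0.
  near=> h.
  rewrite sub0r normrN /= addr0 {2}/flat ltxx subr0 /GRing.scale/= mulr1.
  have [h0|h0] := ltP 0 h; last by rewrite /flat (le_gtF h0) mulr0 normr0 ltW.
  have h1 : h < 1.
    rewrite (le_lt_trans (ler_norm _))//; near: h; apply: dnbhs0_lt; exact: ltr01.
  have hC : h <= e / (C + 1).
    rewrite (le_trans (ler_norm _))//; near: h; apply: dnbhs0_le.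
    by rewrite divr_gt0// ltr_wpDl.
  rewrite normrM normfV (gtr0_norm h0) mulrC ler_pdivrMr//.
  apply: (le_trans (HC _ h0 h1)).
  move: hC; rewrite ler_pdivlMr ?ltr_wpDl// expr2; nra.
Unshelve. all: by end_near.
Qed.

End smooth_functions.

Section smooth_class.
Context {R : realType}.

(* Smooth functions generated by a set [B] of linear functions; the class is
   stable under differentiation because [flat] is. *)
Inductive smooth (V : normedModType R) (B : set (V -> R)) : (V -> R) -> Prop :=
| smooth_cst c : smooth B (cst c)
| smooth_base f : B f -> smooth B f
| smoothD f g : smooth B f -> smooth B g -> smooth B (f + g)
| smoothM f g : smooth B f -> smooth B g -> smooth B (f * g)
| smooth_flat q f : smooth B f -> smooth B (flat q \o f).

(** Linearity is expressed through the derivative: along [v] it equals [f v] at every point. This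
    covers the identity of [R] and the coordinates of a row vector alike. *)
Definition linear_base (V : normedModType R) (B : set (V -> R)) : Prop :=
  forall f, B f -> continuous f /\ forall x v, is_derive x v f (f v).

(** Directional derivatives are reduced to one variable, where the chain rule and explicit
    computations take place. *)
Lemma is_derive_line (V : normedModType R) (f : V -> R) (x v : V) (d : R) :
  is_derive x v f d <-> is_derive (0 : R) 1 (fun h : R => f (x + h *: v)) d.
Proof.
have E : (fun h => h^-1 *: ((f \o shift x) (h *: v) - f x)) =
   (fun h => h^-1 *: (((fun h : R => f (x + h *: v)) \o shift 0) (h *: (1 : R)) -
      (fun h : R => f (x + h *: v)) 0)).
  by apply/funext => h /=; rewrite scale0r !addr0 [h%:A]mulr1 [x + _]addrC.
by split=> -[dx dE]; split; move: dx dE; rewrite /derivable /derive E.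
Qed.

Lemma is_derive_comp (V : normedModType R) (g : R -> R) (f : V -> R) (x v : V)
    (a b : R) :
  is_derive (f x) 1 g a -> is_derive x v f b -> is_derive x v (g \o f) (a * b).
Proof.
move=> dg /is_derive_line df; apply/is_derive_line.
by apply: (@is_derive1_comp _ g (fun h : R => f (x + h *: v))); rewrite ?scale0r ?addr0.
Qed.

Lemma smooth_continuous (V : normedModType R) (B : set (V -> R)) (f : V -> R) :
  linear_base B -> smooth B f -> continuous f.
Proof.
move=> HB; elim=> {f} [c|f /HB[]//|f g _ cf _ cg|f g _ cf _ cg|q f _ cf] x.
- exact: cvg_cst.
- exact: continuousD (cf x) (cg x).
- exact: continuousM (cf x) (cg x).
- apply: continuous_comp (cf x) _.
  have [+ _] := is_derive_flat q (f x).
  by move=> /derivable1_diffP /differentiable_continuous.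
Qed.

Lemma smooth_is_derive (V : normedModType R) (B : set (V -> R)) (f : V -> R) (v : V) :
  linear_base B -> smooth B f ->
  exists2 f', smooth B f' & forall x, is_derive x v f (f' x).
Proof.
move=> HB; elim=> {f} [c|f Bf|f g sf [f' sf' df] sg [g' sg' dg]
  |f g sf [f' sf' df] sg [g' sg' dg]|q f sf [f' sf' df]].
- by exists (cst 0); [exact: smooth_cst|move=> x; exact: is_derive_cst].
- exists (cst (f v)); first exact: smooth_cst.
  by move=> x; have [_] := HB f Bf; exact.
- by exists (f' + g'); [exact: smoothD|move=> x; exact: is_deriveD].
- exists (f * g' + g * f'); first by apply: smoothD; exact: smoothM.
  by move=> x; exact: is_deriveM.
- exists ((flat ('X^2 * (q - q^`())) \o f) * f').
    by apply: smoothM => //; exact: smooth_flat.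
  by move=> x; apply: is_derive_comp => //; exact: is_derive_flat.
Qed.

Lemma smooth_derive (V : normedModType R) (B : set (V -> R)) (f : V -> R) (v : V) :
  linear_base B -> smooth B f -> smooth B ('D_v f).
Proof.
move=> HB sf; have [f' sf' df] := smooth_is_derive v HB sf.
rewrite (_ : 'D_v f = f')//; apply/funext => x; exact: derive_val.
Qed.

Lemma smooth_derivable (V : normedModType R) (B : set (V -> R)) (f : V -> R) (v x : V) :
  linear_base B -> smooth B f -> derivable f x v.
Proof. by move=> HB sf; have [f' _ /(_ x)[]] := smooth_is_derive v HB sf. Qed.

Lemma linear_base_id : linear_base [set (id : R -> R)].
Proof. by move=> _ ->; split=> [x|x v]; [exact: cvg_id|exact: is_derive_id]. Qed.

Lemma smooth_comp (V : normedModType R) (B : set (V -> R)) (g : R -> R) (f : V -> R) :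
  smooth [set (id : R -> R)] g -> smooth B f -> smooth B (g \o f).
Proof.
move=> + sf; elim=> {g} [c|_ ->//|g h _ sg _ sh|g h _ sg _ sh|q g _ sg].
- exact: smooth_cst.
- exact: smoothD sg sh.
- exact: smoothM sg sh.
- exact: smooth_flat sg.
Qed.

Definition coordinates (n : nat) : set ('rV[R]_n -> R) :=
  range (fun i (x : 'rV[R]_n) => x 0 i).

Lemma linear_base_coordinates n : linear_base (@coordinates n).
Proof.
move=> _ [i _ <-]; split; first by move=> x; exact: coord_continuous.
move=> x v; apply/is_derive_line.
rewrite (_ : (fun _ => _) = cst (x 0 i) + v 0 i *: (id : R -> R)); last first.
  by apply/funext => h; rewrite !mxE fctE/= /GRing.scale/= mulrC.
apply: (is_derive_eq (is_deriveD (is_derive_cst _ _ _) (is_deriveZ _ (is_derive_id _ _)))).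
by rewrite add0r /GRing.scale/= mulr1.
Qed.

Lemma smooth_mpartial n (f : 'rV[R]_n -> R) (s : seq 'I_n) :
  smooth (@coordinates n) f -> smooth (@coordinates n) (mpartial s f).
Proof.
by move=> sf; elim: s => //= i s IH; exact: smooth_derive (@linear_base_coordinates n) IH.
Qed.

Lemma smooth_test_function n (f : 'rV[R]_n -> R) (M : R) :
  smooth (@coordinates n) f ->
  (forall x, f x != 0 -> forall i, `|x 0 i| <= M) -> test_function f.
Proof.
move=> sf fM; split.
  move=> s; have sfs := smooth_mpartial s sf; split.
    exact: smooth_continuous (@linear_base_coordinates n) sfs.
  by move=> i x; exact: smooth_derivable (@linear_base_coordinates n) sfs.
pose K := [set v : 'rV[R]_n | forall i, v ord0 i \in `[(- M), M]].
have cK : compact K.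
  apply: (@rV_compact _  _ (fun=> `[(- M), M]%classic)) => _.
  exact: segment_compact.
apply: (subclosed_compact (@closed_closure _ _) cK).
have clK : closed K.
  apply: compact_closed => //; exact: norm_hausdorff.
rewrite (closure_id K).1//; apply: closure_subset => x /= fx i.
by rewrite in_itv/= -ler_norml; exact: fM.
Qed.

Definition sqnorm n (x : 'rV[R]_n) : R := \sum_i x 0 i ^+ 2.

Lemma smooth_sqnorm n : smooth (@coordinates n) (@sqnorm n).
Proof.
rewrite (_ : @sqnorm n = \sum_i (fun x : 'rV[R]_n => x 0 i) * (fun x : 'rV[R]_n => x 0 i)).
  elim/big_ind : _ => [|f g|i _]; [exact: smooth_cst|exact: smoothD|].
  by apply: smoothM; apply: smooth_base; exists i.
by apply/funext => x; rewrite fct_sumE; apply: eq_bigr => i _; rewrite expr2.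
Qed.

Lemma is_derive_coord n (i j : 'I_n) (x : 'rV[R]_n) :
  is_derive x (delta_mx 0 i) (fun x : 'rV[R]_n => x 0 j) (i == j)%:R.
Proof.
have [_ /(_ x (delta_mx 0 i))] := @linear_base_coordinates n _ (ex_intro2 _ _ j I erefl).
by rewrite mxE eqxx eq_sym.
Qed.

Lemma is_derive_sqnorm n (i : 'I_n) (x : 'rV[R]_n) :
  is_derive x (delta_mx 0 i) (@sqnorm n) (2 * x 0 i).
Proof.
apply/is_derive_line.
rewrite (_ : (fun _ => _) = cst (sqnorm x) + (2 * x 0 i) *: (id : R -> R) + (id : R -> R) * id);
    last first.
  apply/funext => h; rewrite /sqnorm !fctE/= (bigD1 i)//= [in RHS](bigD1 i)//=.
  rewrite (eq_bigr (fun j => x 0 j ^+ 2)); last first.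
    by move=> j ji; rewrite !mxE eqxx (negbTE ji) mulr0 addr0.
  by rewrite !mxE !eqxx mulr1 /GRing.scale/=; ring.
have d1 := is_derive_id (0 : R) 1.
apply: (is_derive_eq (is_deriveD (is_deriveD (is_derive_cst _ _ _) (is_deriveZ _ d1))
  (is_deriveM d1 d1))).
by rewrite /GRing.scale/=; ring.
Qed.

End smooth_class.

(** * Lebesgue measure on row vectors *)

Section rV_measure.
Context {R : realType}.
Local Notation mu n := (@lebesgue_rV R n).

Definition cube n (M : R) : set 'rV[R]_n := [set x | forall i, `|x 0 i| <= M].

Lemma measurable_rV_box n (A : 'I_n -> set R) : (forall i, measurable (A i)) ->
  measurable [set x : 'rV[R]_n | forall i, A i (x 0 i)].
Proof.
move=> mA; rewrite [X in measurable X](_ : _ = \bigcap_(i in [set: 'I_n])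
    ((fun x : 'rV[R]_n => x 0 i) @^-1` A i)); last first.
  by apply/seteqP; split=> x /= h i; [move=> _; exact: h|exact: h].
apply: fin_bigcap_measurable; first exact: finite_finset.
by move=> i _; rewrite -[X in measurable X]setTI; exact: measurable_rV_coor.
Qed.

Lemma cubeE n (M : R) : @cube n M = [set x | forall i, `[- M, M]%classic (x 0 i)].
Proof.
by apply/seteqP; split=> x xM i; have := xM i; rewrite /= in_itv/= ler_norml.
Qed.

Lemma measurable_cube n (M : R) : measurable (@cube n M).
Proof.
rewrite cubeE; apply: (@measurable_rV_box n (fun=> `[- M, M]%classic)) => i.
exact: measurable_itv.
Qed.

Lemma prod_cst_EFin n (c : R) : (\prod_(i < n) c%:E = (c ^+ n)%:E)%E.
Proof. by elim: n => [|n IH]; rewrite ?big_ord0// big_ord_recl IH exprS. Qed.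

Lemma lebesgue_cube n (M : R) : 0 <= M -> mu n (@cube n M) = ((2 * M) ^+ n)%:E.
Proof.
move=> M0; have := @lebesgue_rV_box R n (fun=> `[- M, M]%classic).
rewrite -cubeE => -> => [|i]; last exact: measurable_itv.
under eq_bigr do rewrite lebesgue_measure_itv/= lte_fin.
(* The length of an interval is given by a test for strict inequality of its ends, hence the
   separate degenerate case; in dimension 0 both sides are 1. *)
have [->|M0'] := eqVneq M 0.
  case: n => [|n]; first by rewrite big_ord0 expr0.
  by rewrite big_ord_recl/= oppr0 ltxx mul0e mulr0 expr0n.
rewrite ifT ?gtrN ?lt0r ?M0'// -EFinB opprK.
rewrite (eq_bigr (fun=> (2 * M)%:E)) => [|i _]; last by rewrite mulr_natl.
exact: prod_cst_EFin.
Qed.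

Lemma integrable_cube n (M : R) (F : 'rV[R]_n -> R) (K : R) :
  measurable_fun [set: 'rV[R]_n] F ->
  (forall x, F x != 0 -> @cube n M x /\ `|F x| <= K) ->
  (mu n).-integrable setT (EFin \o F).
Proof.
move=> mF FM.
rewrite (_ : EFin \o F = (EFin \o F) \_ (@cube n M)); last first.
  apply/funext => x; rewrite patchE; case: ifPn => //.
  apply: contraNeq => /= Fx; rewrite inE; apply: (FM x _).1.
  by apply: contra_neq Fx => ->.
have := @integrable_mkcond _ _ _ (mu n) (cube M) (EFin \o F) (measurable_cube M) => -[+ _]; apply.
apply: measurable_bounded_integrable.
- exact: measurable_cube.
- have [M0|M0] := leP 0 M; first by rewrite [ltLHS](lebesgue_cube n M0) ltry.
  apply: le_lt_trans (_ : mu n (@cube n 0) < _)%E.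
    apply: le_measure; rewrite ?inE; [exact: measurable_cube|exact: measurable_cube|].
    by move=> x xM i; rewrite (le_trans (xM i))// ltW.
  by rewrite [ltLHS](lebesgue_cube n (lexx 0)) ltry.
- exact: measurable_funTS.
- exists `|K|; split; first exact: num_real.
  move=> y Ky x _; apply: le_trans (ltW Ky).
  have [->|/FM[_ /le_trans]] := eqVneq (F x) 0; first by rewrite normr0.
  by apply; exact: ler_norm.
Qed.

(** The sigma-algebra is generated by the coordinates, so an open set is written as a countable
    union of boxes with rational centre and radius, which are balls of the sup norm. *)
Lemma open_measurable_rV n (U : set 'rV[R]_n) : open U -> measurable U.
Proof.
move=> oU.
pose box (z : {ffun 'I_n -> rat} * rat) : set 'rV[R]_n :=
  [set x | forall i, `|x 0 i - ratr (z.1 i)| < ratr z.2].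
have mbox z : measurable (box z).
  rewrite [X in measurable X](_ : _ = \bigcap_(i in [set: 'I_n])
    ((fun x : 'rV[R]_n => x 0 i) @^-1` `]ratr (z.1 i) - ratr z.2, ratr (z.1 i) + ratr z.2[%classic)); last first.
    by apply/seteqP; split=> x /= h i; [move=> _|];
      have := h i; rewrite /= in_itv/= -ltr_distl; [|exact].
  apply: fin_bigcap_measurable; first exact: finite_finset.
  move=> i _; rewrite -[X in measurable X]setTI.
  by apply: measurable_rV_coor => //; exact: measurable_itv.
have -> : U = \bigcup_(z in [set z | box z `<=` U]) box z.
  apply/seteqP; split=> [x Ux|x [z]]; last by move=> /[apply].
  have /nbhs_ballP[e /= e0 eU] : nbhs x U by exact: open_nbhs_nbhs.
  have [r] : exists r, ratr r \in `]0, (e / 2)[ by apply: rat_in_itvoo; rewrite divr_gt0.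
  rewrite in_itv/= => /andP[r0 re].
  have /choice[q Hq] : forall i, exists q : rat, `|x 0 i - ratr q| < ratr r.
    move=> i; have [q] : exists q, ratr q \in `](x 0 i - ratr r), (x 0 i + ratr r)[.
      by apply: rat_in_itvoo; lra.
    by rewrite in_itv/= -ltr_distl distrC => ?; exists q.
  exists ([ffun i => q i], r); last by move=> i /=; rewrite ffunE.
  move=> y yb; apply: eU; split => // i j; rewrite ord1.
  have := yb j; have := Hq j; rewrite /= ffunE /ball/= => h1 h2.
  rewrite (_ : x 0 j - y 0 j = (x 0 j - ratr (q j)) - (y 0 j - ratr (q j))); last by ring.
  rewrite (le_lt_trans (ler_normB _ _))//; lra.
rewrite bigcup_mkcond; apply: countable_bigcupT_measurable => [|z]; first exact: countableP.
by case: ifPn.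
Qed.

Lemma continuous_measurable_rV n (F : 'rV[R]_n -> R) :
  continuous F -> measurable_fun [set: 'rV[R]_n] F.
Proof.
move=> cF; apply: (measurability _ (RGenOpens.measurableE R)).
move=> _ [_ [a [b ->] <-]]; rewrite setTI; apply: open_measurable_rV.
by move/continuousP: cF; apply; exact: interval_open.
Qed.

Lemma rV_addZE n (u v : 'rV[R]_n) h i : (u + h *: v) 0 i = u 0 i + h * v 0 i.
Proof. by rewrite !mxE. Qed.

Lemma delta_rVE n (i j : 'I_n) : (delta_mx 0 i : 'rV[R]_n) 0 j = (j == i)%:R.
Proof. by rewrite mxE eqxx. Qed.

Lemma rV_consD n (a h : R) (x : 'rV[R]_n) :
  rV_cons (a, x) + h *: delta_mx 0 ord0 = rV_cons (a + h, x).
Proof.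
apply/rowP => i; rewrite rV_addZE delta_rVE.
case: (unliftP ord0 i) => [j|] ->.
  by rewrite !rV_consS /= mulr0 addr0.
by rewrite !rV_cons0 eqxx mulr1.
Qed.

Lemma rV_consDS n (a h : R) (x : 'rV[R]_n) j :
  rV_cons (a, x) + h *: delta_mx 0 (lift ord0 j) = rV_cons (a, x + h *: delta_mx 0 j).
Proof.
apply/rowP => i; rewrite rV_addZE delta_rVE.
case: (unliftP ord0 i) => [k|] ->.
  by rewrite !rV_consS rV_addZE delta_rVE (inj_eq (@lift_inj _ _)).
by rewrite !rV_cons0/= mulr0 addr0.
Qed.

Lemma integral_deriv_itv0 (f f' : R -> R) (M : R) :
  0 < M ->
  (forall x : R, is_derive x 1 f (f' x)) -> continuous f' ->
  (forall x, M < `|x| -> f x = 0 /\ f' x = 0) ->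
  (\int[lebesgue_measure]_x (f' x)%:E = 0)%E.
Proof.
move=> M0 df cf' f0.
(* The extra 1 puts both ends strictly outside the support, so that [f] vanishes there. *)
rewrite (_ : (fun x => (f' x)%:E) = (EFin \o f') \_ `[- (M + 1), M + 1]); last first.
  apply/funext => x; rewrite patchE; case: ifPn => //.
  rewrite notin_setE/= in_itv/= -ler_norml => /negP; rewrite -ltNge => Mx.
  by rewrite (f0 x _).2// (lt_trans _ Mx)// ltrDl.
rewrite -integral_mkcond (@continuous_FTC2 _ f' f).
- rewrite (f0 (M + 1)%R _).1; last by rewrite gtr0_norm ?addr_gt0// ltrDl.
  rewrite (f0 (- (M + 1))%R _).1; last by rewrite normrN gtr0_norm ?addr_gt0// ltrDl.
  by rewrite subee.
- lra.
- exact: continuous_subspaceT.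
- have cf : continuous f.
    by move=> x; have [/derivable1_diffP/differentiable_continuous] := df x.
  split=> [x _||]; first exact: ex_derive.
    by apply: cvg_at_right_filter; exact: cf.
  by apply: cvg_at_left_filter; exact: cf.
- by move=> x _; rewrite derive1E; exact: derive_val.
Qed.

(** Induction along the construction of the measure by adding a first coordinate. Fubini integrates
    first over the remaining coordinates if [i] is one of them, and over the first one otherwise.
    Continuity along lines and a global bound are assumed because they pass to slices. *)
Lemma integral_partial_rV n (i : 'I_n) (F F' : 'rV[R]_n -> R) (M K : R) :
  0 < M ->
  measurable_fun [set: 'rV[R]_n] F' ->
  (forall x, is_derive x (delta_mx 0 i) F (F' x)) ->
  (forall x, continuous (fun h : R => F' (x + h *: delta_mx 0 i))) ->
  (forall x, ~ @cube n M x -> F x = 0 /\ F' x = 0) ->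
  (forall x, `|F' x| <= K) ->
  (\int[mu n]_x (F' x)%:E = 0)%E.
Proof.
move=> M0; elim: n i F F' => [[]//|n IH] i F F' mF' dF cF' FM F'K.
have iF' : (mu n.+1).-integrable setT (EFin \o F').
  apply: (@integrable_cube _ M _ K) => // x F'x; split=> //.
  by apply: contrapT => /FM[_]; exact/eqP.
pose Fc (z : measurableTypeR R * 'rV[R]_n) := (F' (rV_cons z))%:E.
have mF'c : measurable_fun [set: _] Fc.
  apply: (measurableT_comp (f := EFin \o F')); last exact: measurable_rV_cons.
  exact: measurableT_comp.
have icons : (@lebesgue_measure R \x mu n)%E.-integrable [set: _] Fc.
  apply/integrableP; split=> //.
  move/integrableP : iF' => [mF'e].
  rewrite /= ge0_integral_pushforward//; first exact: measurable_rV_cons.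
  by apply/measurable_EFinP; exact: measurableT_comp.
rewrite /= integral_pushforward//; [|exact: measurable_rV_cons|exact: measurableT_comp].
rewrite preimage_setT.
have [j|] := unliftP ord0 i; move=> iE; subst i.
- rewrite -(integral12_prod_meas1 icons) /fubini_F/=.
  rewrite integral0_eq// => a _.
  apply: (IH j (fun x => F (rV_cons (a, x))) (fun x => F' (rV_cons (a, x)))).
  + apply: (measurableT_comp (f := F')) => //.
    apply: (measurableT_comp (f := @rV_cons R n)); first exact: measurable_rV_cons.
    exact: measurable_pair1.
  + move=> x; apply/is_derive_line; have /is_derive_line := dF (rV_cons (a, x)).
    by under eq_fun do rewrite rV_consDS.
  + by move=> x; under eq_fun do rewrite -rV_consDS; exact: cF'.
  + move=> x xM; apply: FM => /= axM; apply: xM => k.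
    by have := axM (lift ord0 k); rewrite rV_consS.
  + by move=> x; exact: F'K.
- rewrite -(integral21_prod_meas1 icons) /fubini_G/=.
  rewrite integral0_eq// => x _.
  have consE (a h : R) : rV_cons (a + h, x) = rV_cons (a, x) + h *: delta_mx 0 ord0 by rewrite rV_consD.
  apply: (@integral_deriv_itv0 (fun a => F (rV_cons (a, x))) (fun a => F' (rV_cons (a, x))) M) => //.
  + move=> a; apply/is_derive_line; have /is_derive_line := dF (rV_cons (a, x)).
    by under eq_fun do rewrite -consE; under [X in _ -> is_derive _ _ X _]eq_fun do rewrite [_ *: 1]mulr1.
  + have := cF' (rV_cons (0, x)); under eq_fun do rewrite -consE add0r.
    exact.
  + move=> a Ma; apply: FM => axM; move: Ma; apply/negP; rewrite -leNgt.
    by have := axM ord0; rewrite rV_cons0.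
Qed.

End rV_measure.

(** * Compactly supported and radial functions *)

Section compactly_supported.
Context {R : realType} (n : nat).
Local Notation mu := (@lebesgue_rV R n).
Implicit Types (F : 'rV[R]_n -> R) (i : 'I_n).

Lemma compact_cube (M : R) : compact (@cube R n M).
Proof.
by rewrite cubeE; apply: (@rV_compact _ _ (fun=> `[- M, M]%classic)) => _; exact: segment_compact.
Qed.

Lemma closed_cube (M : R) : closed (@cube R n M).
Proof. by apply: compact_closed; [exact: norm_hausdorff|exact: compact_cube]. Qed.

Lemma coord_le_norm (x : 'rV[R]_n) i : `|x 0 i| <= `|x|.
Proof.
rewrite [leRHS]/Num.norm /= mx_normrE; apply/bigmax_geP; right => /=.
by exists (0, i).
Qed.

Lemma continuous_cube_bounded F (M : R) : continuous F ->
  exists2 K : R, 0 <= K & forall x, cube M x -> `|F x| <= K.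
Proof.
move=> cF; have [M0|nM] := pselect (@cube R n M !=set0); last first.
  by exists 0 => // x Mx; case: nM; exists x.
have := @EVT_max_rV _ _ (fun x => `|F x|) _ M0 (@compact_cube M).
case=> [|c _ cmax]; last first.
  by exists `|F c| => // x Mx; apply: cmax; rewrite inE.
by apply: continuous_subspaceT => x; apply: continuous_comp (cF x) _; exact: norm_continuous.
Qed.

Lemma derive_eq0_notin_closure F i x :
  ~ closure [set y | F y != 0] x -> partial i F x = 0.
Proof.
move=> xF; rewrite /partial (@near_eq_derive _ _ _ F (cst 0)) ?derive_cst//.
have : open (~` closure [set y | F y != 0]) by apply: closed_openC; exact: closed_closure.
move=> oC; have := open_nbhs_nbhs (conj oC xF); apply: filterS => y yF.
by apply/eqP; apply: contra_notT yF => Fy; exact: subset_closure.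
Qed.

Lemma derive_eq0_notin_cube F i (M : R) x :
  (forall x, F x != 0 -> cube M x) -> ~ cube M x -> partial i F x = 0.
Proof.
move=> FM xM; apply: derive_eq0_notin_closure => /closureS Fx; apply: xM.
by rewrite (closure_id (cube M)).1; [exact: Fx|exact: closed_cube].
Qed.

Lemma test_function_cube F : test_function F ->
  exists2 M : R, 0 < M & forall x, F x != 0 -> cube M x.
Proof.
move=> [_ cF]; have [M [Mreal HM]] := compact_bounded cF.
exists (`|M| + 1) => [|x Fx i]; first by rewrite ltr_wpDl.
apply: (le_trans (coord_le_norm x i)); apply: HM.
  by rewrite (le_lt_trans (ler_norm _))// ltrDl.
exact: subset_closure.
Qed.

Definition C1c i F := [/\ continuous F, forall x, derivable F x (delta_mx 0 i),
  continuous (partial i F) & exists2 M : R, 0 < M & forall x, F x != 0 -> cube M x].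

Lemma test_function_C1c i F : test_function F -> C1c i F.
Proof.
move=> tF; have [M M0 FM] := test_function_cube tF.
have [smF _] := tF; split; last by exists M.
- exact: (smF [::]).1.
- by move=> x; exact: (smF [::]).2.
- exact: (smF [:: i]).1.
Qed.

Lemma test_function_partial i F : test_function F -> test_function (partial i F).
Proof.
move=> [smF cF]; split.
  (* [mpartial] is a right fold, so the derivative taken first is the last entry of the sequence. *)
  by move=> s; have := smF (rcons s i); rewrite /mpartial foldr_rcons.
apply: subclosed_compact cF _; first exact: closed_closure.
rewrite (closure_id (closure [set x | F x != 0])).1; last exact: closed_closure.
apply: closureS => x /= Fx; apply: contrapT => /derive_eq0_notin_closure.
by move=> /(_ i) Fx0; move: Fx; rewrite Fx0 eqxx.
Qed.

Lemma integral_partial_C1c i F : C1c i F -> \int[mu]_x partial i F x = 0.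
Proof.
move=> [cF dF cF' [M M0 FM]].
have [K K0 HK] := continuous_cube_bounded M cF'.
suff I0 : (\int[mu]_x (partial i F x)%:E = 0)%E by rewrite /Rintegral I0.
apply: (@integral_partial_rV _ _ i F _ M K) => //.
- exact: continuous_measurable_rV.
- move=> x h; apply: (@continuous_comp _ _ _ (fun h : R => x + h *: delta_mx 0 i)); last exact: cF'.
  apply: continuousD; first exact: cvg_cst.
  by apply: (@scalel_continuous).
- move=> x Mx; split; last exact: derive_eq0_notin_cube Mx.
  by apply/eqP; apply: contra_notT Mx; exact: FM.
- move=> x; have [/HK//|Mx] := pselect (cube M x).
  by rewrite (derive_eq0_notin_cube _ FM)// normr0.
Qed.

Lemma C1cM i F G : C1c i F -> C1c i G -> C1c i (F * G).
Proof.
move=> [cF dF cF' [M M0 FM]] [cG dG cG' _]; split.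
- by move=> x; apply: continuousM; [exact: cF|exact: cG].
- by move=> x; exact: derivableM.
- rewrite (_ : partial i _ = F * partial i G + G * partial i F).
    move=> x; apply: continuousD; apply: continuousM;
      [exact: cF|exact: cG'|exact: cG|exact: cF'].
  by apply/funext => x; rewrite /partial deriveM.
- exists M => // x FGx; apply: FM; apply: contra_neq FGx => Fx0.
  by rewrite fctE Fx0 mul0r.
Qed.

Lemma integrable_continuous_cube F (M : R) : continuous F ->
  (forall x, F x != 0 -> cube M x) -> mu.-integrable setT (EFin \o F).
Proof.
move=> cF FM; have [K _ HK] := continuous_cube_bounded M cF.
apply: (@integrable_cube _ _ M _ K); first exact: continuous_measurable_rV.
by move=> x /FM Mx; split=> //; exact: HK.
Qed.

Lemma C1c_integration_by_parts i F G : C1c i F -> C1c i G ->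
  \int[mu]_x (F x * partial i G x) = - \int[mu]_x (partial i F x * G x).
Proof.
move=> cF cG; have := integral_partial_C1c (C1cM cF cG).
have [F0 dF F' [M M0 FM]] := cF; have [G0 dG G' _] := cG.
rewrite (_ : partial i _ = fun x => F x * partial i G x + partial i F x * G x); last first.
  by apply/funext => x; rewrite /partial deriveM// /GRing.scale/= [G x * _]mulrC.
rewrite RintegralD//; first by move=> /eqP; rewrite addr_eq0 => /eqP.
- apply: (@integrable_continuous_cube _ M) => [x|x].
    by apply: continuousM; [exact: F0|exact: G'].
  by move=> FGx; apply: FM; apply: contra_neq FGx => Fx0; rewrite Fx0 mul0r.
- apply: (@integrable_continuous_cube _ M) => [x|x].
    by apply: continuousM; [exact: F'|exact: G0].
  move=> FGx; apply: contrapT => /(derive_eq0_notin_cube i FM) Fx0.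
  by move: FGx; rewrite Fx0 mul0r eqxx.
Qed.

End compactly_supported.

Section radial_functions.
Context {R : realType} (n : nat).
Local Notation smooth1 := (smooth [set (id : R -> R)]).
Implicit Types (h : R -> R) (c : R).

Lemma smooth1_is_derive h (z : R) : smooth1 h -> is_derive z 1 h (derive1 h z).
Proof.
by move=> sh; rewrite derive1E; apply: DeriveDef => //; exact: smooth_derivable linear_base_id sh.
Qed.

Lemma smooth1_derive1 h : smooth1 h -> smooth1 (derive1 h).
Proof.
move=> /(smooth_derive (1 : R) linear_base_id).
by rewrite (_ : derive1 h = 'D_1 h)//; apply/funext => z; rewrite derive1E.
Qed.

(** Radial profiles are functions of |x|^2 rather than |x|: the inner function is then a polynomial,
    smooth at the origin too. *)
Lemma smooth_radial h c : smooth1 h ->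
  smooth (@coordinates R n) (fun x => h (c * sqnorm x)).
Proof.
move=> sh; apply: (smooth_comp sh (f := fun x => c * sqnorm x)).
by apply: (smoothM (smooth_cst _ c)); exact: smooth_sqnorm.
Qed.

Lemma is_derive_radial h c (i : 'I_n) x : smooth1 h ->
  is_derive x (delta_mx 0 i) (fun x => h (c * sqnorm x))
    (2 * c * x 0 i * derive1 h (c * sqnorm x)).
Proof.
move=> sh.
have dn : is_derive x (delta_mx 0 i) (fun x : 'rV[R]_n => c * sqnorm x) (c * (2 * x 0 i)).
  by have := is_deriveZ c (is_derive_sqnorm i x).
apply: (is_derive_eq (is_derive_comp (smooth1_is_derive _ sh) dn)); ring.
Qed.

Lemma is_derive_coord_radial h c (i : 'I_n) x : smooth1 h ->
  is_derive x (delta_mx 0 i) (fun x => x 0 i * h (c * sqnorm x))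
    (h (c * sqnorm x) + 2 * c * x 0 i ^+ 2 * derive1 h (c * sqnorm x)).
Proof.
move=> sh.
apply: (is_derive_eq (is_deriveM (is_derive_coord i i x) (is_derive_radial c i x sh))).
by rewrite eqxx mulr1n /GRing.scale/=; ring.
Qed.

Lemma laplacian_radial h c x : smooth1 h ->
  laplacian (fun x : 'rV[R]_n => h (c * sqnorm x)) x =
  2 * c * (n%:R * derive1 h (c * sqnorm x)
    + 2 * (c * sqnorm x) * derive1 (derive1 h) (c * sqnorm x)).
Proof.
move=> sh; rewrite /laplacian /mpartial/=.
have dE i : partial i (fun x : 'rV[R]_n => h (c * sqnorm x)) =
    (2 * c) *: (fun x : 'rV[R]_n => x 0 i * derive1 h (c * sqnorm x)).
  apply/funext => y; rewrite /partial; have [_ ->] := is_derive_radial c i y sh.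
  exact: (esym (mulrA (2 * c) (y 0 i) _)).
under eq_bigr => i _.
  rewrite dE /partial.
  have [_ ->] := is_deriveZ (2 * c) (is_derive_coord_radial c i x (smooth1_derive1 sh)).
  over.
rewrite /GRing.scale/= -mulr_sumr; congr (_ * _).
rewrite big_split/= sumr_const card_ord; congr (_ + _); first by rewrite mulr_natl.
by rewrite -mulr_suml -mulr_sumr /sqnorm mulrA.
Qed.

End radial_functions.

(** * Mollification by dilation *)

Section dilation_kernels.
Context {R : realType} (n : nat).
Local Notation mu := (@lebesgue_rV R n).
Local Notation smooth1 := (smooth [set (id : R -> R)]).
Implicit Types (g : R -> R) (r : R) (x : 'rV[R]_n) (Phi : 'rV[R]_n -> R).

(** The variable [z] stands for |x|^2 / r^2; when A > 0, the function x -> g (|x|^2 / r^2) is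
    supported in an annulus away from the origin. *)
Definition annular (A B : R) g := smooth1 g /\ forall z, g z != 0 -> A <= z <= B.

(* [r |-> r ^- j * g (s / r ^ 2)] has derivative [r ^- j.+1 * dil j g (s / r ^ 2)] *)
Definition dil (j : nat) g : R -> R := fun z => - (j%:R * g z + 2 * z * derive1 g z).

Lemma annular_derive1_eq0 A B g z : annular A B g -> ~~ (A <= z <= B) -> derive1 g z = 0.
Proof.
move=> [sg gAB] zAB; rewrite derive1E (@near_eq_derive _ _ _ g (cst 0)) ?derive_cst//.
have : open (~` `[A, B]%classic) by apply: closed_openC; exact: itv_closed.
move=> oC; have zC : (~` `[A, B]%classic) z by rewrite /= in_itv/=; exact/negP.
have := open_nbhs_nbhs (conj oC zC); apply: filterS => y /=.
by rewrite in_itv/= => yAB; apply/eqP; apply: contra_notT yAB => /gAB.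
Qed.

Lemma annular_dil A B j g : annular A B g -> annular A B (dil j g).
Proof.
move=> ag; have [sg gAB] := ag; split.
  rewrite (_ : dil j g = cst (-1) * (cst j%:R * g + cst 2 * id * derive1 g)); last first.
    apply/funext => z; rewrite /dil.
    by rewrite -[RHS]/(-1 * (j%:R * g z + 2 * z * derive1 g z)) mulN1r.
  apply: smoothM; first exact: smooth_cst.
  apply: smoothD; apply: smoothM => //; [exact: smooth_cst| |exact: smooth1_derive1].
  by apply: smoothM; [exact: smooth_cst|exact: smooth_base].
move=> z; apply: contraNT => zAB; rewrite /dil (annular_derive1_eq0 ag zAB).
have -> : g z = 0 by apply/eqP; apply: contraNT zAB => /gAB.
by rewrite !mulr0 addr0 oppr0.
Qed.

Lemma annular_bounded A B g : annular A B g ->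
  exists2 K : R, 0 <= K & forall z, `|g z| <= K.
Proof.
move=> [sg gAB].
have cg : continuous g by exact: smooth_continuous linear_base_id sg.
have [BA|AB] := ltP B A.
  exists 0 => // z; have [->|/gAB/andP[Az zB]] := eqVneq (g z) 0; first by rewrite normr0.
  by have := le_lt_trans (le_trans Az zB) BA; rewrite ltxx.
have [|c cAB cmax] := @EVT_max R (fun z => `|g z|) A B AB.
  by apply: continuous_subspaceT => z; apply: continuous_comp (cg z) _; exact: norm_continuous.
exists `|g c| => // z; have [->|/gAB zAB] := eqVneq (g z) 0; first by rewrite normr0.
by apply: cmax; rewrite in_itv.
Qed.

(** For j = n the integral over R^n is invariant under dilation; each derivative in r raises [j] by
    one and replaces [g] by [dil j g]. *)
Definition kernel (j : nat) g r x : R := r ^- j * g (r ^- 2 * sqnorm x).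

Lemma is_derive_exprVn (j : nat) r : 0 < r ->
  is_derive r 1 (fun r => r ^- j) (- (j%:R * r ^- j.+1)).
Proof.
move=> r0; have rj : ((id : R -> R) ^+ j) r != 0 by rewrite exprfctE expf_neq0// lt0r_neq0.
have dX : is_derive r 1 ((id : R -> R) ^+ j) (j%:R * r ^+ j.-1).
  by apply: is_derive_eq; rewrite /GRing.scale/= ?exprfctE ?mulr1.
have -> : (fun r => r ^- j) = (fun r => (((id : R -> R) ^+ j) r)^-1).
  by apply/funext => y; rewrite exprfctE.
split; first by apply: derivableV => //; exact: ex_derive.
rewrite deriveV//.
have [_ ->] := dX; rewrite /GRing.scale/= exprfctE.
case: j {rj dX} => [|j]; first by rewrite !mul0r mulr0 oppr0.
by rewrite /= !exprS; field; rewrite ?expf_neq0 ?lt0r_neq0.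
Qed.

Lemma is_derive_kernel A B j g r x : annular A B g -> 0 < r ->
  is_derive r 1 (fun r => kernel j g r x) (kernel j.+1 (dil j g) r x).
Proof.
move=> [sg _] r0.
have ds : is_derive r 1 (fun r => r ^- 2 * sqnorm x) (- (2 * r ^- 3) * sqnorm x).
  have -> : (fun r => r ^- 2 * sqnorm x) = sqnorm x *: (fun r => r ^- 2).
    by apply/funext => y; rewrite mulrC.
  have := is_derive_exprVn 2 r0 => ?; apply: is_derive_eq.
  by rewrite /GRing.scale/= mulrC.
have dg := @is_derive1_comp _ g _ r _ _ (smooth1_is_derive _ sg) ds.
apply: (is_derive_eq (is_deriveM (is_derive_exprVn j r0) dg)).
rewrite /kernel /dil /GRing.scale/= !exprS expr0; field.
by rewrite lt0r_neq0//= expf_neq0// lt0r_neq0.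
Qed.

Lemma sqnorm_ge0 x : 0 <= sqnorm x.
Proof. by apply: sumr_ge0 => i _; rewrite sqr_ge0. Qed.

Lemma sqnorm_cube x (M : R) : 0 <= M -> sqnorm x <= M ^+ 2 -> cube M x.
Proof.
move=> M0 xM i; rewrite -(ger0_norm M0) -ler_sqr ?nnegrE// !real_normK ?num_real//.
apply: le_trans xM; rewrite /sqnorm (bigD1 i)//= lerDl.
by apply: sumr_ge0 => j _; rewrite sqr_ge0.
Qed.

(** Uniformity for r in [r1, r2] is what provides the dominating function when the integral is
    differentiated in r. *)
Lemma kernel_support A B j g (r1 r2 : R) : 0 < A -> annular A B g ->
  0 < r1 -> r1 <= r2 ->
  exists M K : R, 0 <= K /\ forall r, r1 <= r <= r2 -> forall x, kernel j g r x != 0 ->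
    [/\ A * r1 ^+ 2 <= sqnorm x, cube M x & `|kernel j g r x| <= K].
Proof.
move=> A0 ag r10 r12; have [K K0 gK] := annular_bounded ag.
(* With t = B r2^2 >= 0, the bound |x|^2 <= t <= (t + 1)^2 avoids a square root. *)
exists (B * r2 ^+ 2 + 1), (r1 ^- j * K); split.
  by rewrite mulr_ge0// invr_ge0 exprn_ge0// ltW.
move=> r /andP[r1r rr2] x kx; have r0 := lt_le_trans r10 r1r.
have /(ag.2)/andP[Ax xB] : g (r ^- 2 * sqnorm x) != 0.
  by apply: contra_neq kx => gx; rewrite /kernel gx mulr0.
have rr0 : 0 < r ^+ 2 by rewrite exprn_gt0.
have r11 : r1 ^+ 2 <= r ^+ 2 by rewrite lerXn2r ?nnegrE ?(ltW r0) ?(ltW r10).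
have r22 : r ^+ 2 <= r2 ^+ 2 by rewrite lerXn2r ?nnegrE ?(ltW r0)// (le_trans (ltW r0)).
have {}Ax : A * r ^+ 2 <= sqnorm x by rewrite -ler_pdivlMr// mulrC.
have {}xB : sqnorm x <= B * r ^+ 2 by rewrite -ler_pdivrMr// mulrC.
have B0 : 0 < B by have := mulr_gt0 A0 rr0; nra.
split.
- by apply: le_trans Ax; rewrite ler_pM2l.
- have : 0 <= B * r2 ^+ 2 by rewrite mulr_ge0 ?ltW// exprn_gt0// (lt_le_trans r0).
  by move=> Br2; apply: sqnorm_cube; [rewrite addr_ge0|nra].
- rewrite /kernel normrM ler_pM//.
  rewrite normfV ger0_norm ?exprn_ge0 ?(ltW r0)// lef_pV2 ?posrE ?exprn_gt0//.
  by rewrite lerXn2r ?nnegrE ?(ltW r0) ?(ltW r10).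
Qed.

(** The solution may be singular at the origin, like the Green function; the kernels vanish near it,
    so bounds outside each neighbourhood suffice. *)
Definition bounded_away Phi := forall a : R, 0 < a ->
  exists K : R, forall x, a <= sqnorm x -> `|Phi x| <= K.

Lemma measurable_kernel A B j g r : annular A B g ->
  measurable_fun [set: 'rV[R]_n] (kernel j g r).
Proof.
move=> [sg _]; apply: measurable_funM => //; apply: continuous_measurable_rV.
exact: (smooth_continuous (@linear_base_coordinates R n) (smooth_radial n (r ^- 2) sg)).
Qed.

Lemma integrable_kernel Phi A B j g r : 0 < A -> annular A B g -> 0 < r ->
  measurable_fun [set: 'rV[R]_n] Phi -> bounded_away Phi ->
  mu.-integrable setT (EFin \o (fun x => Phi x * kernel j g r x)).
Proof.
move=> A0 ag r0 mPhi bPhi.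
have [M [K [K0 HK]]] := kernel_support j A0 ag r0 (lexx r).
have [|K' HK'] := bPhi (A * r ^+ 2); first by rewrite mulr_gt0// exprn_gt0.
apply: (@integrable_cube _ _ M _ (K' * K)).
  by apply: measurable_funM => //; exact: measurable_kernel ag.
move=> x; rewrite mulf_eq0 negb_or => /andP[_ kx].
have [|Ax Mx kK] := HK r _ x kx; first by rewrite lexx.
by split=> //; rewrite normrM ler_pM// HK'.
Qed.

Definition dilation_avg Phi j g r := \int[mu]_x (Phi x * kernel j g r x).

(** Differentiation under the integral over the interval ]r/2, 2r[, dominated by a constant on a
    fixed cube; only the kernel is differentiated, so [Phi] need only be measurable and bounded away
    from the origin. *)
Lemma is_derive_dilation_avg Phi A B j g r : 0 < A -> annular A B g -> 0 < r ->
  measurable_fun [set: 'rV[R]_n] Phi -> bounded_away Phi ->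
  is_derive r 1 (dilation_avg Phi j g) (dilation_avg Phi j.+1 (dil j g) r).
Proof.
move=> A0 ag r0 mPhi bPhi.
have r20 : 0 < r / 2 by rewrite divr_gt0.
have r22 : r / 2 <= 2 * r by lra.
have ag' := annular_dil j ag.
have [M [K [K0 HK]]] := kernel_support j.+1 A0 ag' r20 r22.
have [|K' HK'] := bPhi (A * (r / 2) ^+ 2); first by rewrite mulr_gt0// exprn_gt0.
have dk (s : R) x : 0 < s -> is_derive s 1 (fun s => Phi x * kernel j g s x)
    (Phi x * kernel j.+1 (dil j g) s x).
  move=> s0; exact: (is_deriveZ (Phi x) (is_derive_kernel j x ag s0)).
have partialE (s : R) x : 0 < s -> partial1of2 (fun s x => Phi x * kernel j g s x) s x =
    Phi x * kernel j.+1 (dil j g) s x.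
  by move=> s0; rewrite partial1of2E; have [_ ->] := dk s x s0.
pose H x : R := `|K' * K| * \1_(@cube R n M) x.
have H0 x : 0 <= H x by rewrite mulr_ge0.
have iH : mu.-integrable setT (EFin \o H).
  apply: (@integrable_cube _ _ M _ `|K' * K|).
    by apply: measurable_funM => //; apply: measurable_indic; exact: measurable_cube.
  move=> x; rewrite /H indicE; case: (boolP (x \in _)) => [|_].
    by rewrite inE mulr1 normr_id.
  by rewrite mulr0 eqxx.
have Ir : `](r / 2), (2 * r)[%classic r by rewrite /= in_itv/=; lra.
have int s : `](r / 2), (2 * r)[%classic s ->
    mu.-integrable setT (EFin \o (fun x => Phi x * kernel j g s x)).
  rewrite /= in_itv/= => /andP[s1 _].
  by apply: (integrable_kernel _ A0 ag) => //; exact: lt_trans s1.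
have der s x : `](r / 2), (2 * r)[%classic s -> [set: 'rV[R]_n] x ->
    derivable (fun s : R => Phi x * kernel j g s x) s 1.
  by rewrite /= in_itv/= => /andP[s1 _] _; have [] := dk s x (lt_trans r20 s1).
have bnd s x : `](r / 2), (2 * r)[%classic s -> [set: 'rV[R]_n] x ->
    `|partial1of2 (fun s x => Phi x * kernel j g s x) s x| <= H x.
  rewrite /= in_itv/= => /andP[s1 s2] _; rewrite partialE ?(lt_trans r20 s1)//.
  have [->|kx] := eqVneq (kernel j.+1 (dil j g) s x) 0; first by rewrite mulr0 normr0.
  have [|Ax Mx kK] := HK s _ x kx; first by rewrite !ltW.
  rewrite /H indicE mem_set// mulr1 (le_trans _ (ler_norm _))//.
  by rewrite normrM ler_pM// HK'.
have := @cvg_differentiation_under_integral R _ _ mu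
  (fun s x => Phi x * kernel j g s x) setT measurableT r (r / 2) (2 * r)
  Ir int der H H0 iH bnd.
have -> : \int[mu]_x partial1of2 (fun s x => Phi x * kernel j g s x) r x =
    dilation_avg Phi j.+1 (dil j g) r.
  by apply: eq_Rintegral => x _; exact: partialE.
have -> : (fun h => h^-1 *: (dilation_avg Phi j g (h + r) - dilation_avg Phi j g r)) =
    (fun h => h^-1 *: ((dilation_avg Phi j g \o shift r) (h *: (1 : R)) - dilation_avg Phi j g r)).
  by apply/funext => h /=; rewrite [h%:A]mulr1.
by move=> cvgF; split; [apply/cvg_ex; eexists; exact: cvgF|exact: cvg_lim cvgF].
Qed.

Lemma integrable_Rintegral_sum (I : Type) (s : seq I) (f : I -> 'rV[R]_n -> R) :
  (forall i, mu.-integrable setT (EFin \o f i)) ->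
  mu.-integrable setT (EFin \o (fun x => \sum_(i <- s) f i x)) /\
  \int[mu]_x (\sum_(i <- s) f i x) = \sum_(i <- s) \int[mu]_x f i x.
Proof.
move=> intf; elim: s => [|i s [ints IH]].
  have -> : (fun x => \sum_(i <- [::]) f i x) = cst 0.
    by apply/funext => x; rewrite big_nil.
  by rewrite big_nil; split; [exact: integrable0|rewrite Rintegral_cst// mul0r].
have -> : (fun x => \sum_(j <- i :: s) f j x) = (fun x => f i x + \sum_(j <- s) f j x).
  by apply/funext => x; rewrite big_cons.
by rewrite big_cons -IH; split; [exact: (integrableD _ (intf i) ints)|rewrite RintegralD].
Qed.

Lemma annular_test_function A B g c : 0 < c -> annular A B g ->
  test_function (fun x : 'rV[R]_n => g (c * sqnorm x)).
Proof.
move=> c0 [sg gAB]; apply: (@smooth_test_function _ _ _ (B / c + 1)).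
  exact: smooth_radial.
move=> x /gAB /andP[_ xB]; have := sqnorm_ge0 x.
have {}xB : sqnorm x <= B / c by rewrite ler_pdivlMr// mulrC.
by move=> s0; apply: sqnorm_cube; nra.
Qed.

(* Up to the factor [- r ^- n.+1], the [r]-derivative of the kernel is the
   divergence of [x |-> g (sqnorm x / r ^ 2) x]. *)
Lemma dilation_mass_const A B g r : 0 < A -> annular A B g -> 0 < r ->
  dilation_avg (cst 1) n g r = dilation_avg (cst 1) n g 1.
Proof.
move=> A0 ag; have [sg gAB] := ag.
have m1 : measurable_fun [set: 'rV[R]_n] (cst 1 : 'rV[R]_n -> R) by exact: measurable_cst.
have b1 : bounded_away (cst 1) by move=> a _; exists 1 => x _; rewrite normr1.
have dm s (s0 : 0 < s) := is_derive_dilation_avg n A0 ag s0 m1 b1.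
have dm0 s : 0 < s -> dilation_avg (cst 1) n.+1 (dil n g) s = 0.
  move=> s0; have c0 : 0 < s ^- 2 by rewrite invr_gt0 exprn_gt0.
  pose F i (x : 'rV[R]_n) := x 0 i * g (s ^- 2 * sqnorm x).
  have dF i x : partial i (F i) x =
      g (s ^- 2 * sqnorm x) + 2 * s ^- 2 * x 0 i ^+ 2 * derive1 g (s ^- 2 * sqnorm x).
    by have [_ <-] := is_derive_coord_radial (s ^- 2) i x sg.
  have tF i : test_function (F i).
    have [M M0 HM] := test_function_cube (annular_test_function c0 ag).
    apply: (@smooth_test_function _ _ _ M).
      by apply: smoothM; [apply: smooth_base; exists i|exact: smooth_radial].
    by move=> x; rewrite mulf_eq0 negb_or => /andP[_ /HM].
  have C1F i := test_function_C1c i (tF i).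
  have -> : dilation_avg (cst 1) n.+1 (dil n g) s =
      \int[mu]_x (- s ^- n.+1 * \sum_i partial i (F i) x).
    apply: eq_Rintegral => x _; rewrite /kernel /dil mul1r mulNr mulrN; congr (- (_ * _)).
    under eq_bigr do rewrite dF.
    rewrite big_split/= sumr_const card_ord mulr_natl; congr (_ + _).
    by rewrite -mulr_suml -mulr_sumr /sqnorm mulrA.
  have intF i : mu.-integrable setT (EFin \o partial i (F i)).
    have [_ _ cF [M M0 FM]] := C1F i.
    apply: (integrable_continuous_cube cF (M := M)) => x Fx; apply: contrapT => Mx.
    by move: Fx; rewrite (derive_eq0_notin_cube i FM Mx) eqxx.
  have [intS _] := integrable_Rintegral_sum (index_enum 'I_n) intF.
  rewrite RintegralZl//.
  have [_ ->] := integrable_Rintegral_sum (index_enum 'I_n) intF.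
  by rewrite big1 ?mulr0// => i _; exact: integral_partial_C1c (C1F i).
have cst_lt (a b : R) : 0 < a -> a < b ->
    dilation_avg (cst 1) n g a = dilation_avg (cst 1) n g b.
  move=> a0 ab; have [z /andP[az _] /eqP] := MVT_pos dm a0 ab.
  by rewrite dm0 ?(lt_trans a0)// mul0r subr_eq0 => /eqP.
move=> r0; have [r1|r1|->//] := ltgtP r 1; first exact: cst_lt.
by apply/esym; exact: cst_lt.
Qed.

Lemma derive1_dil j g z : smooth1 g ->
  derive1 (dil j g) z =
  - (j%:R * derive1 g z + 2 * derive1 g z + 2 * z * derive1 (derive1 g) z).
Proof.
move=> sg; have dg := smooth1_is_derive z sg.
have dg' := smooth1_is_derive z (smooth1_derive1 sg).
have -> : dil j g = - (j%:R *: g + (2 *: id) * derive1 g).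
  by apply/funext => y; rewrite /dil.
rewrite derive1E; have [_ ->] := is_deriveN (is_deriveD (is_deriveZ j%:R dg)
  (is_deriveM (is_deriveZ 2 (is_derive_id z 1)) dg')).
by rewrite /GRing.scale/= -[2 *: z]/(2 * z); ring.
Qed.

(** The radial operator in r, applied to the kernel of degree n, is the Laplacian in x of the same
    kernel multiplied by z = |x|^2 / r^2. For radial u this is the kernel form of the scaling rule:
    the radial Laplacian of r -> u(r y) is |y|^2 times the Laplacian of u at r y. *)
Lemma laplacian_kernel g r x : smooth1 g -> 0 < r ->
  laplacian (fun x => r ^- n * (r ^- 2 * sqnorm x * g (r ^- 2 * sqnorm x))) x =
  kernel n.+2 (dil n.+1 (dil n g)) r x + (n%:R - 1) / r * kernel n.+1 (dil n g) r x.
Proof.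
move=> sg r0; pose h : R -> R := fun z => r ^- n * (z * g z).
have sh : smooth1 h.
  rewrite (_ : h = cst (r ^- n) * (id * g))//.
  apply: smoothM; first exact: smooth_cst.
  by apply: smoothM => //; exact: smooth_base.
rewrite (laplacian_radial (r ^- 2) x sh).
have h'E : derive1 h = r ^- n *: (g + id * derive1 g).
  apply/funext => z; rewrite derive1E (_ : h = r ^- n *: (id * g))//.
  have [_ ->] := is_deriveZ (r ^- n) (is_deriveM (is_derive_id z 1) (smooth1_is_derive z sg)).
  by rewrite !fctE /GRing.scale/=; ring.
have h''E z : derive1 (derive1 h) z = r ^- n * (2 * derive1 g z + z * derive1 (derive1 g) z).
  rewrite h'E derive1E.
  have [_ ->] := is_deriveZ (r ^- n) (is_deriveD (smooth1_is_derive z sg)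
    (is_deriveM (is_derive_id z 1) (smooth1_is_derive z (smooth1_derive1 sg)))).
  by rewrite /GRing.scale/=; ring.
rewrite h''E h'E /kernel /dil -/(dil n g) derive1_dil// !exprS expr0.
rewrite -[(r ^- n *: (g + id * derive1 g)) _]/(r ^- n * (g _ + _ * derive1 g _)).
set z := _ * sqnorm x; rewrite /dil -natr1; field.
by rewrite ?expf_neq0 ?lt0r_neq0.
Qed.

End dilation_kernels.

Section mollification.
Context {R : realType}.

Definition bump (e : R) (z : R) : R := flat 1 (z - (1 - e)) * flat 1 (1 + e - z).

Lemma flat1_gt0 (z : R) : (0 < flat 1 z) = (0 < z).
Proof.
by rewrite /flat; case: ifP => // _; rewrite ?ltxx// hornerC mul1r expR_gt0.
Qed.

Lemma flat1_ge0 (z : R) : 0 <= flat 1 z.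
Proof. by rewrite /flat; case: ifP => // _; rewrite hornerC mul1r expR_ge0. Qed.

Lemma bump_ge0 e z : 0 <= bump e z.
Proof. by rewrite mulr_ge0 ?flat1_ge0. Qed.

Lemma bump_gt0 e z : 1 - e < z -> z < 1 + e -> 0 < bump e z.
Proof. by move=> ez ze; rewrite mulr_gt0 ?flat1_gt0 ?subr_gt0. Qed.

Lemma annular_bump e : annular (1 - e) (1 + e) (bump e).
Proof.
split.
  rewrite (_ : bump e = (flat 1 \o (id + cst (- (1 - e)))) *
    (flat 1 \o (cst (1 + e) + cst (-1) * id))); last first.
    by apply/funext => z; rewrite /bump !fctE /= mulN1r.
  apply: smoothM; apply: smooth_flat; apply: smoothD; try exact: smooth_cst.
    exact: smooth_base.
  by apply: smoothM; [exact: smooth_cst|exact: smooth_base].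
move=> z; rewrite mulf_eq0 negb_or => /andP[].
rewrite !neq_lt !(le_gtF (flat1_ge0 _)) !flat1_gt0/= !subr_gt0 => /ltW -> /ltW ->.
by [].
Qed.

Context (k : nat).
Local Notation mu := (@lebesgue_rV R k.+1).

(** An explicit box next to a unit vector has positive measure, and [bump e] has a positive minimum
    over the values of |x|^2 on it. *)
Lemma bump_mass_gt0 (e : R) : 0 < e <= 4^-1 ->
  0 < dilation_avg (n := k.+1) (cst 1) k.+1 (bump e) 1.
Proof.
move=> /andP[e0 e4]; have [sb bAB] := annular_bump e.
have A0 : 0 < 1 - e by lra.
pose N := (k.+1)%:R : R.
have N1 : 1 <= N by rewrite ler1n.
(* On the box |x|^2 <= 1 + 2 eta + N eta^2 <= 1 + 3 eta <= 1 + 3 e / 4, which stays inside the open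
   window of the bump. *)
pose eta := e / (4 * N).
have eta0 : 0 < eta by rewrite divr_gt0// mulr_gt0// (lt_le_trans ltr01).
have etaN : 4 * (N * eta) = e by rewrite /eta; field; rewrite gt_eqF// (lt_le_trans ltr01).
pose A (i : 'I_k.+1) : set R := if i == ord0 then `[1, 1 + eta]%classic else `[0, eta]%classic.
pose box : set 'rV[R]_k.+1 := [set x | forall i, A i (x 0 i)].
have mA i : measurable (A i) by rewrite /A; case: ifP => _; exact: measurable_itv.
have muA i : lebesgue_measure (A i) = eta%:E.
  rewrite /A; case: ifP => _; rewrite lebesgue_measure_itv/= lte_fin.
    by rewrite ltrDl eta0 -EFinB addrAC subrr add0r.
  by rewrite eta0 -EFinB subr0.
have mubox : mu box = (eta ^+ k.+1)%:E.
  rewrite [LHS](lebesgue_rV_box mA) (eq_bigr (fun=> eta%:E)) => [|i _]; last exact: muA.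
  exact: prod_cst_EFin.
have mbox : measurable box by exact: measurable_rV_box.
have boxE x : box x -> 1 <= sqnorm x <= 1 + 3 * e / 4.
  move=> bx; have := bx ord0; rewrite /A eqxx /= in_itv/= => /andP[x1 x2].
  rewrite /sqnorm big_ord_recl/=.
  have rest i : 0 <= x 0 (lift ord0 i) ^+ 2 <= eta ^+ 2.
    have := bx (lift ord0 i); rewrite /A /= in_itv/= => /andP[y1 y2].
    by rewrite sqr_ge0 lerXn2r ?nnegrE// ltW.
  have s0 : 0 <= \sum_(i < k) x 0 (lift ord0 i) ^+ 2.
    by apply: sumr_ge0 => i _; have /andP[] := rest i.
  have s1 : \sum_(i < k) x 0 (lift ord0 i) ^+ 2 <= k%:R * eta ^+ 2.
    apply: (@le_trans _ _ (\sum_(i < k) eta ^+ 2)).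
      by apply: ler_sum => i _; have /andP[] := rest i.
    by rewrite sumr_const card_ord mulr_natl.
  have Nk : N = k%:R + 1 by rewrite /N -natr1.
  have k0 : 0 <= k%:R :> R by rewrite ler0n.
  apply/andP; split; first by nra.
  have : N * eta ^+ 2 <= eta by nra.
  nra.
have e34 : (1 : R) <= 1 + 3 * e / 4 by lra.
have [|c] := @EVT_min R (bump e) 1 (1 + 3 * e / 4) e34.
  by apply: continuous_subspaceT; exact: smooth_continuous linear_base_id sb.
rewrite in_itv/= => /andP[c1 c2] cmin.
have cbump : 0 < bump e c by apply: bump_gt0; lra.
apply: (@lt_le_trans _ _ (bump e c * eta ^+ k.+1)); first by rewrite mulr_gt0// exprn_gt0.
have ibox : mu.-integrable setT (EFin \o (\1_box : 'rV[R]_k.+1 -> R)).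
  apply: (@integrable_cube _ _ 2 _ 1); first exact: measurable_indic.
  move=> x; rewrite indicE; case: (boolP (x \in box)) => [|_]; last by rewrite eqxx.
  rewrite inE => /boxE/andP[_ xb] _; split; last by rewrite normr1.
  by apply: sqnorm_cube => //; lra.
have -> : bump e c * eta ^+ k.+1 = \int[mu]_x (bump e c * \1_box x).
  rewrite RintegralZl//; congr (_ * _).
  by rewrite /Rintegral integral_indic// setIT; rewrite [X in fine X]mubox.
apply: le_Rintegral => //.
- have := @integrableZl _ _ _ mu setT measurableT (bump e c) _ ibox.
  by apply.
- apply: (integrable_kernel _ A0 (annular_bump e)) => //.
  by move=> a _; exists 1 => x _; rewrite normr1.
- move=> x _; rewrite /kernel !expr1n invr1 !mul1r indicE.
  case: (boolP (x \in box)) => [|_]; last by rewrite mulr0 bump_ge0.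
  by rewrite inE mulr1 => bx; apply: cmin; rewrite in_itv/=; exact: boxE.
Qed.

Variables (p : R) (phi : R -> R).
Hypothesis phi_gt0 : forall r, 0 < r -> 0 < phi r.
Hypothesis phi_decr : forall r s, 0 < r -> r <= s -> phi s <= phi r.
Hypothesis p_gt0 : 0 < p.
Let Phi (x : 'rV[R]_k.+1) := phi (enorm x).
Hypothesis mPhi : measurable_fun [set: 'rV[R]_k.+1] Phi.
Hypothesis weak_eq : forall psi : 'rV[R]_k.+1 -> R, test_function psi ->
  (exists2 d : R, 0 < d & forall x, sqnorm x < d -> psi x = 0) ->
  \int[mu]_x (Phi x * laplacian psi x) = \int[mu]_x (Phi x `^ p * psi x).

Let bounded_Phi : bounded_away Phi.
Proof.
move=> a a0; exists (phi (Num.sqrt a)) => x ax.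
have sa0 : 0 < Num.sqrt a by rewrite sqrtr_gt0.
have sx : Num.sqrt a <= enorm x by rewrite ler_wsqrtr.
by rewrite ger0_norm ?phi_decr// ltW// phi_gt0// (lt_le_trans sa0).
Qed.

Let bounded_Phip : bounded_away (fun x => Phi x `^ p).
Proof.
move=> a a0; have [K HK] := bounded_Phi a0.
exists (K `^ p) => x ax; rewrite ger0_norm ?powR_ge0//.
have Phi0 : 0 < Phi x by apply: phi_gt0; rewrite sqrtr_gt0 (lt_le_trans a0).
apply: le_powR; rewrite ?(ltW p_gt0) ?(ltW Phi0)//.
by rewrite (le_trans (ler_norm _))// HK.
Qed.

Let measurable_Phip : measurable_fun [set: 'rV[R]_k.+1] (fun x => Phi x `^ p).
Proof. exact: (measurableT_comp (measurable_powR p) mPhi). Qed.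

Let kernel_ge0 e j r x : 0 < r -> 0 <= kernel (n := k.+1) j (bump e) r x.
Proof. by move=> r0; rewrite mulr_ge0 ?bump_ge0// invr_ge0 exprn_ge0// ltW. Qed.

(** The window restricts |x|^2 / r^2; since (1 - e)^2 <= 1 - e and 1 + e <= (1 + e)^2, the ratio |x|
    / r lies in the same interval. *)
Let bump_enorm e r (x : 'rV[R]_k.+1) : 0 < e <= 4^-1 -> 0 < r -> bump e (r ^- 2 * sqnorm x) != 0 ->
  [/\ (1 - e) * r <= enorm x, enorm x <= (1 + e) * r,
      1 - e <= r ^- 2 * sqnorm x & r ^- 2 * sqnorm x <= (1 + e)].
Proof.
move=> /andP[e0 e4] r0 /((annular_bump e).2)/andP[es se]; split=> //.
  have rr0 : 0 < r ^+ 2 by rewrite exprn_gt0.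
  have {}es : (1 - e) * r ^+ 2 <= sqnorm x by rewrite -ler_pdivlMr// mulrC.
  have y0 : 0 <= (1 - e) * r by rewrite mulr_ge0 ?(ltW r0)//; lra.
  rewrite -(ger0_norm y0) -sqrtr_sqr ler_wsqrtr// (le_trans _ es)// exprMn.
  by rewrite ler_pM2r//; nra.
have rr0 : 0 < r ^+ 2 by rewrite exprn_gt0.
have {}se : sqnorm x <= (1 + e) * r ^+ 2 by rewrite -ler_pdivrMr// mulrC.
have y0 : 0 <= (1 + e) * r by rewrite mulr_ge0 ?(ltW r0)//; lra.
rewrite -(ger0_norm y0) -sqrtr_sqr ler_wsqrtr// (le_trans se)// exprMn.
by rewrite ler_pM2r//; nra.
Qed.

(** Because the mass [m] is the same for all r, dividing by it makes [V] a genuine mean of [phi]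
    without affecting the derivatives in r. *)
Lemma mollified_bump (e : R) : 0 < e <= 4^-1 ->
  exists V V1 V2, mollified k p phi e V V1 V2.
Proof.
move=> e14; have /andP[e0 e4] := e14.
have A0 : 0 < 1 - e by lra.
have ab := annular_bump e; have [sb _] := ab.
set m := dilation_avg (n := k.+1) (cst 1) k.+1 (bump e) 1.
have m0 : 0 < m by exact: bump_mass_gt0.
have massE r : 0 < r -> dilation_avg (n := k.+1) (cst 1) k.+1 (bump e) r = m.
  by move=> r0; rewrite (dilation_mass_const k.+1 A0 ab r0).
have ab1 := annular_dil k.+1 ab.
pose D j g r := m^-1 * dilation_avg Phi j g r.
exists (D k.+1 (bump e)), (D k.+2 (dil k.+1 (bump e))), (D k.+3 (dil k.+2 (dil k.+1 (bump e)))).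
have intK r : 0 < r -> mu.-integrable setT (EFin \o kernel k.+1 (bump e) r).
  move=> r0.
  have -> : kernel k.+1 (bump e) r = (fun x : 'rV[R]_k.+1 => cst 1 x * kernel k.+1 (bump e) r x).
    by apply/funext => x; rewrite /= mul1r.
  apply: (integrable_kernel _ A0 ab) => //.
  by move=> a _; exists 1 => x _; rewrite normr1.
have squeeze r (F : 'rV[R]_k.+1 -> R) L U : 0 < r ->
    mu.-integrable setT (EFin \o F) ->
    (forall x, L * kernel k.+1 (bump e) r x <= F x <= U * kernel k.+1 (bump e) r x) ->
    L <= m^-1 * \int[mu]_x F x <= U.
  move=> r0 intF LFU; rewrite mulrC ler_pdivlMr// ler_pdivrMr// -(massE r r0).
  have massE' c : c * dilation_avg (n := k.+1) (cst 1) k.+1 (bump e) r =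
      \int[mu]_x (c * kernel k.+1 (bump e) r x).
    rewrite RintegralZl//; last exact: intK.
    by congr (_ * _); apply: eq_Rintegral => x _; rewrite /= mul1r.
  rewrite !massE'; apply/andP; split; apply: le_Rintegral => //.
  + by have := @integrableZl _ _ _ mu setT measurableT L _ (intK r r0); apply.
  + by move=> x _; have /andP[] := LFU x.
  + by have := @integrableZl _ _ _ mu setT measurableT U _ (intK r r0); apply.
  + by move=> x _; have /andP[] := LFU x.
split.
- move=> r r0; have := is_derive_dilation_avg k.+1 A0 ab r0 mPhi bounded_Phi.
  by move=> /(is_deriveZ m^-1).
- move=> r r0; have := is_derive_dilation_avg k.+2 A0 ab1 r0 mPhi bounded_Phi.
  by move=> /(is_deriveZ m^-1).
- move=> r r0; apply: (squeeze r) => //; first exact: (integrable_kernel _ A0 ab).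
  move=> x; have [bx|/(bump_enorm e14 r0)[h1 h2 _ _]] := eqVneq (bump e (r ^- 2 * sqnorm x)) 0.
    by rewrite /kernel bx !mulr0 lexx.
  have K0 := kernel_ge0 e k.+1 x r0.
  have a0 : 0 < (1 - e) * r by rewrite mulr_gt0.
  have x0 : 0 < enorm x := lt_le_trans a0 h1.
  by rewrite !ler_wpM2r ?phi_decr.
- move=> r r0.
  (* The profile whose Laplacian in x is the radial operator applied to the kernel. The weak
     equation turns the integral into one of Phi^p against z times the kernel, with z between 1 - e
     and 1 + e. *)
  pose h : R -> R := fun z => r ^- k.+1 * (z * bump e z).
  have c0 : 0 < r ^- 2 by rewrite invr_gt0 exprn_gt0.
  have ah : annular (1 - e) (1 + e) h.
    split; last first.
      move=> z hz; apply: ab.2; apply: contra_neq hz => bz.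
      by rewrite /h bz !mulr0.
    rewrite (_ : h = cst (r ^- k.+1) * (id * bump e))//.
    apply: smoothM; first exact: smooth_cst.
    by apply: smoothM => //; exact: smooth_base.
  have hE x : h (r ^- 2 * sqnorm x) = r ^- 2 * sqnorm x * kernel (n := k.+1) k.+1 (bump e) r x.
    by rewrite /h /kernel; ring.
  have -> : D k.+3 (dil k.+2 (dil k.+1 (bump e))) r + k%:R / r * D k.+2 (dil k.+1 (bump e)) r =
      m^-1 * \int[mu]_x (Phi x * laplacian (fun x : 'rV[R]_k.+1 => h (r ^- 2 * sqnorm x)) x).
    have i3 := integrable_kernel k.+3 A0 (annular_dil k.+2 ab1) r0 mPhi bounded_Phi.
    have i2 := integrable_kernel k.+2 A0 ab1 r0 mPhi bounded_Phi.
    rewrite /D mulrCA -mulrDr; congr (_ * _).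
    rewrite /dilation_avg -RintegralZl// -RintegralD//; last first.
      by have := @integrableZl _ _ _ mu setT measurableT (k%:R / r) _ i2; apply.
    apply: eq_Rintegral => x _; rewrite laplacian_kernel// -natr1 addrK; ring.
  rewrite weak_eq; last 2 first.
  + exact: annular_test_function c0 ah.
  + exists ((1 - e) * r ^+ 2); first by rewrite mulr_gt0// exprn_gt0.
    move=> x sx; apply/eqP; apply: contraLR sx => /(ah.2)/andP[h1 _].
    by rewrite -leNgt -ler_pdivlMr ?exprn_gt0// mulrC.
  apply: (squeeze r) => //.
    have := integrable_kernel 0 A0 ah r0 measurable_Phip bounded_Phip.
    by congr (mu.-integrable _ (EFin \o _)); apply/funext => x; rewrite /kernel expr0 invr1 mul1r.
  move=> x; rewrite hE.
  have [bx|/(bump_enorm e14 r0)[h1 h2 h3 h4]] := eqVneq (bump e (r ^- 2 * sqnorm x)) 0.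
    by rewrite /kernel bx !mulr0 lexx.
  have K0 := kernel_ge0 e k.+1 x r0.
  have a0 : 0 < (1 - e) * r by rewrite mulr_gt0.
  have x0 : 0 < enorm x := lt_le_trans a0 h1.
  have P1 : phi ((1 + e) * r) `^ p <= Phi x `^ p.
    apply: le_powR; rewrite ?(ltW p_gt0)//; last exact: phi_decr.
    by rewrite ltW// phi_gt0// (lt_le_trans x0).
  have P2 : Phi x `^ p <= phi ((1 - e) * r) `^ p.
    by apply: le_powR; rewrite ?(ltW p_gt0)//; [rewrite ltW// phi_gt0|exact: phi_decr].
  have P0 : 0 <= phi ((1 + e) * r) `^ p by exact: powR_ge0.
  rewrite [X in _ <= X <= _]mulrA; apply/andP; split; rewrite ler_wpM2r//.
    by rewrite [leRHS]mulrC ler_pM// ltW.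
  by rewrite [leLHS]mulrC ler_pM ?powR_ge0// (le_trans (ltW A0)).
Qed.

End mollification.

(** * The equation away from the origin *)

Local Open Scope complex_scope.

Section complex_pairing.
Context {R : realType} (n : nat).
Local Notation mu := (@lebesgue_rV R n).
Local Notation Re := complex.Re.
Local Notation Im := complex.Im.
Local Notation normc := (@ComplexField.Normc.normc R).
Implicit Types (f : 'rV[R]_n -> R[i]) (psi : 'rV[R]_n -> R).

Lemma normcE (z : R[i]) : normc z = Num.sqrt (Re z ^+ 2 + Im z ^+ 2).
Proof. by case: z. Qed.

Lemma normc_ge0 (z : R[i]) : 0 <= normc z.
Proof. by rewrite normcE sqrtr_ge0. Qed.

Lemma Re_le_normc (z : R[i]) : `|Re z| <= normc z.
Proof. by rewrite normcE -sqrtr_sqr ler_wsqrtr// lerDl sqr_ge0. Qed.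

Lemma Im_le_normc (z : R[i]) : `|Im z| <= normc z.
Proof. by rewrite normcE -sqrtr_sqr ler_wsqrtr// lerDr sqr_ge0. Qed.

Lemma normc_real (r : R) : normc r%:C = `|r|.
Proof. by rewrite normcE/= expr0n/= addr0 sqrtr_sqr. Qed.

Lemma measurable_normc f : cmeasurable f ->
  measurable_fun [set: 'rV[R]_n] (normc \o f).
Proof.
move=> [mr mi].
rewrite (_ : _ \o _ = fun x => Num.sqrt (Re (f x) ^+ 2 + Im (f x) ^+ 2)); last first.
  by apply/funext => x /=; rewrite normcE.
apply: (measurableT_comp (continuous_measurable_fun (@sqrt_continuous R))).
by apply: measurable_funD; exact: measurable_funX.
Qed.

Lemma Lnormc_lty q f : 0 < q ->
  (Lnormc q f < +oo)%E <-> (\int[mu]_x (normc (f x) `^ q)%:E < +oo)%E.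
Proof.
move=> q0.
have E : (\int[mu]_x `|(normc (f x))%:E| `^ q = \int[mu]_x (normc (f x) `^ q)%:E)%E.
  by apply: eq_integral => x _; rewrite /= ger0_norm ?normc_ge0// poweR_EFin.
split=> h.
  rewrite -E -[ltLHS](@poweR_Lnorm _ _ _ mu (EFin \o (normc \o f)) q); last exact: lt0r_neq0.
  exact: poweR_lty.
by rewrite /Lnormc unlock /= E; exact: poweR_lty.
Qed.

Lemma memLp_integrable q f : 0 < q -> memLp q f ->
  mu.-integrable setT (EFin \o (fun x => normc (f x) `^ q)).
Proof.
move=> q0 [mf /(Lnormc_lty _ q0) fq]; apply/integrableP; split.
  apply/measurable_EFinP; apply: (measurableT_comp (measurable_powR q)).
  exact: measurable_normc.
by under eq_integral do rewrite /= ger0_norm ?powR_ge0//.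
Qed.

Definition cc psi := continuous psi /\ exists M : R, forall x, psi x != 0 -> cube M x.

Lemma C1c_cc i psi : C1c i psi -> cc psi /\ cc (partial i psi).
Proof.
move=> [c0 _ c1 [M M0 HM]]; split; split=> //; exists M => // x px.
by apply: contrapT => Mx; move: px; rewrite (derive_eq0_notin_cube i HM Mx) eqxx.
Qed.

Lemma cc_lin psi chi (a b : R) : cc psi -> cc chi -> cc (fun x => a * psi x + b * chi x).
Proof.
move=> [cpsi [M HM]] [cchi [M' HM']]; split.
  move=> x; apply: (@continuousD _ _ _ (cst a * psi) (cst b * chi)); apply: continuousM;
    [exact: cst_continuous|exact: cpsi|exact: cst_continuous|exact: cchi].
exists (Num.max M M') => x; have [px|/HM h _ j] := eqVneq (psi x) 0.
  rewrite px mulr0 add0r mulf_eq0 negb_or => /andP[_ /HM' h] j.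
  by rewrite le_max (h j) orbT.
by rewrite le_max (h j).
Qed.

Lemma cc_sum (I : Type) (s : seq I) (psi : I -> 'rV[R]_n -> R) :
  (forall i, cc (psi i)) -> cc (fun x => \sum_(i <- s) psi i x).
Proof.
move=> cpsi; elim: s => [|i s cs].
  rewrite (_ : (fun x => _) = cst 0); last by apply/funext => x; rewrite big_nil.
  by split; [exact: cst_continuous|exists (0 : R) => x; rewrite /= eqxx].
rewrite (_ : (fun x => _) = (fun x => 1 * psi i x + 1 * \sum_(j <- s) psi j x)).
  exact: cc_lin (cpsi i) cs.
by apply/funext => x; rewrite big_cons !mul1r.
Qed.

Lemma cc_memLp q psi : 0 < q -> cc psi -> memLp q (fun x => (psi x)%:C).
Proof.
move=> q0 [cpsi [M HM]]; have [K K0 HK] := continuous_cube_bounded M cpsi.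
have mpsi := continuous_measurable_rV cpsi.
have cm : cmeasurable (fun x => (psi x)%:C) by split=> //=; exact: measurable_cst.
split=> //; apply/Lnormc_lty => //.
have : mu.-integrable setT (EFin \o (fun x => normc (psi x)%:C `^ q)).
  apply: (@integrable_cube _ _ M _ (K `^ q)).
    apply: (measurableT_comp (measurable_powR q)).
    exact: (measurable_normc cm).
  move=> x; rewrite normc_real => px.
  have Mx : cube M x by apply: HM; apply: contra_neq px => ->; rewrite normr0 powR0// gt_eqF.
  by split=> //; rewrite ger0_norm ?powR_ge0// le_powR ?(ltW q0)// HK.
move=> /integrableP[_].
by under eq_integral do rewrite /= ger0_norm ?powR_ge0//.
Qed.

Definition loc_integrable f := forall psi, cc psi ->
  mu.-integrable setT (EFin \o (fun x => Re (f x) * psi x)) /\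
  mu.-integrable setT (EFin \o (fun x => Im (f x) * psi x)).

(** On the support of the test function, |f| <= 1 + |f|^q. *)
Lemma memLp_loc_integrable q f : 1 <= q -> memLp q f -> loc_integrable f.
Proof.
move=> q1 fq psi [cpsi [M HM]].
have q0 : 0 < q by exact: lt_le_trans q1.
have [K K0 HK] := continuous_cube_bounded M cpsi.
have mpsi := continuous_measurable_rV cpsi.
have [[mr mi] _] := fq.
have ifq := memLp_integrable q0 fq.
have icube : mu.-integrable setT (EFin \o (\1_(@cube R n M) : 'rV[R]_n -> R)).
  apply: (@integrable_cube _ _ M _ 1).
    by apply: measurable_indic; exact: measurable_cube.
  by move=> x; rewrite indicE; case: (boolP (x \in _)) => [|_]; rewrite ?inE ?normr1 ?eqxx.
have iH : mu.-integrable setT (EFin \o (fun x => K * (\1_(@cube R n M) x + normc (f x) `^ q))).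
  have := @integrableZl _ _ _ mu setT measurableT K _ (integrableD measurableT icube ifq).
  by apply.
have key (g : 'rV[R]_n -> R) : measurable_fun [set: 'rV[R]_n] g ->
    (forall x, `|g x| <= normc (f x)) ->
    mu.-integrable setT (EFin \o (fun x => g x * psi x)).
  move=> mg gf; apply: (le_integrable measurableT _ _ iH).
    by apply/measurable_EFinP; exact: measurable_funM.
  move=> x _; rewrite lee_fin/=.
  have [->|px] := eqVneq (psi x) 0; first by rewrite mulr0 normr0.
  have Mx := HM x px.
  rewrite indicE mem_set// normrM [leRHS]ger0_norm; last first.
    by rewrite mulr_ge0// addr_ge0// powR_ge0.
  rewrite mulrC ler_pM// ?HK// (le_trans (gf x))//.
  have [f1|f1] := leP (normc (f x)) 1; first by rewrite (le_trans f1)// lerDl powR_ge0.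
  rewrite -[leLHS]powRr1 ?normc_ge0// ler_wpDl// ler_powR// ltW//.
by split; apply: key => // x; [exact: Re_le_normc|exact: Im_le_normc].
Qed.

Definition pairing f psi : R[i] := cintegral (fun x => f x * (psi x)%:C).

Lemma Re_mulrC (z : R[i]) (r : R) : Re (z * r%:C) = Re z * r.
Proof. by case: z => a b; simpc. Qed.

Lemma Im_mulrC (z : R[i]) (r : R) : Im (z * r%:C) = Im z * r.
Proof. by case: z => a b; simpc. Qed.

Lemma pairingE f psi : pairing f psi =
  (\int[mu]_x (Re (f x) * psi x)) +i* (\int[mu]_x (Im (f x) * psi x)).
Proof.
by congr (_ +i* _); apply: eq_Rintegral => x _; rewrite ?Re_mulrC ?Im_mulrC.
Qed.

Lemma pairing_lin f psi chi (a b : R) : loc_integrable f -> cc psi -> cc chi ->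
  pairing f (fun x => a * psi x + b * chi x) =
  a%:C * pairing f psi + b%:C * pairing f chi.
Proof.
move=> lf cpsi cchi; have [r1 i1] := lf _ cpsi; have [r2 i2] := lf _ cchi.
have key (g : 'rV[R]_n -> R) : mu.-integrable setT (EFin \o (fun x => g x * psi x)) ->
    mu.-integrable setT (EFin \o (fun x => g x * chi x)) ->
    \int[mu]_x (g x * (a * psi x + b * chi x)) =
    a * \int[mu]_x (g x * psi x) + b * \int[mu]_x (g x * chi x).
  move=> j1 j2; rewrite -!RintegralZl// -RintegralD//; first last.
    by have := @integrableZl _ _ _ mu setT measurableT b _ j2; apply.
    by have := @integrableZl _ _ _ mu setT measurableT a _ j1; apply.
  by apply: eq_Rintegral => x _; ring.
by rewrite !pairingE !key//; simpc.
Qed.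

Lemma pairing_sum (I : Type) (s : seq I) f (psi : I -> 'rV[R]_n -> R) :
  loc_integrable f -> (forall i, cc (psi i)) ->
  pairing f (fun x => \sum_(i <- s) psi i x) = \sum_(i <- s) pairing f (psi i).
Proof.
move=> lf cpsi; elim: s => [|i s IH].
  rewrite big_nil pairingE.
  have E (g : 'rV[R]_n -> R) : \int[mu]_x (g x * \sum_(i <- [::]) psi i x) = 0.
    transitivity (\int[mu]_x (cst 0 x : R)); last by rewrite Rintegral_cst// mul0r.
    by apply: eq_Rintegral => x _; rewrite big_nil mulr0.
  by rewrite !E.
rewrite big_cons -IH -[pairing f (psi i)]mul1r -[in RHS](mul1r (pairing _ (fun x => \sum_(j <- s) _))).
rewrite -(pairing_lin 1 1 lf (cpsi i) (cc_sum s cpsi)); congr (pairing f _).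
by apply/funext => x; rewrite big_cons !mul1r.
Qed.

Lemma pairing_add f g (c : R[i]) psi : loc_integrable f -> loc_integrable g -> cc psi ->
  pairing (fun x => f x + c * g x) psi = pairing f psi + c * pairing g psi.
Proof.
move=> lf lg cpsi; have [r1 i1] := lf _ cpsi; have [r2 i2] := lg _ cpsi.
case: c => a b.
have key (g1 g2 g3 : 'rV[R]_n -> R) (u v : R) :
    mu.-integrable setT (EFin \o (fun x => g1 x * psi x)) ->
    mu.-integrable setT (EFin \o (fun x => g2 x * psi x)) ->
    mu.-integrable setT (EFin \o (fun x => g3 x * psi x)) ->
    \int[mu]_x ((g1 x + (u * g2 x + v * g3 x)) * psi x) =
    \int[mu]_x (g1 x * psi x) +
      (u * \int[mu]_x (g2 x * psi x) + v * \int[mu]_x (g3 x * psi x)).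
  move=> j1 j2 j3.
  have ju : mu.-integrable setT (EFin \o (fun x => u * (g2 x * psi x))).
    by have := @integrableZl _ _ _ mu setT measurableT u _ j2; apply.
  have jv : mu.-integrable setT (EFin \o (fun x => v * (g3 x * psi x))).
    by have := @integrableZl _ _ _ mu setT measurableT v _ j3; apply.
  rewrite -!RintegralZl// -RintegralD// -RintegralD//; last first.
    exact: (integrableD measurableT ju jv).
  by apply: eq_Rintegral => x _; ring.
have ReE (z w : R[i]) : Re (z + (a +i* b) * w) = Re z + (a * Re w + - b * Im w).
  by case: z w => [z1 z2] [w1 w2]; simpc; rewrite /=; ring.
have ImE (z w : R[i]) : Im (z + (a +i* b) * w) = Im z + (a * Im w + b * Re w).
  by case: z w => [z1 z2] [w1 w2]; simpc; rewrite /=; ring.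
rewrite !pairingE.
under eq_Rintegral do rewrite ReE.
under [X in _ +i* X = _]eq_Rintegral do rewrite ImE.
by rewrite !key//; simpc; congr (_ +i* _); ring.
Qed.

End complex_pairing.

Section weak_equation.
Context {R : realType} (N : nat) (alpha p lambda : R).
Local Notation mu := (@lebesgue_rV R N).
Local Notation Re := complex.Re.
Local Notation Im := complex.Im.
Local Notation normc := (@ComplexField.Normc.normc R).
Variables (G : 'rV[R]_N -> R[i]) (phi : R -> R).
Hypothesis p1 : 1 < p.
Hypothesis hG : is_green lambda G.
Hypothesis phi_gt0 : forall r, 0 < r -> 0 < phi r.

Lemma conjc_r (r : R) : conjc r%:C = r%:C.
Proof. by rewrite /conjc /= oppr0. Qed.

Lemma inner_real (f : 'rV[R]_N -> R[i]) (psi : 'rV[R]_N -> R) :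
  inner f (fun x => (psi x)%:C) = pairing f psi.
Proof. by rewrite /inner /pairing; congr cintegral; apply/funext => x; rewrite conjc_r. Qed.

Lemma conjc_inner_real (f : 'rV[R]_N -> R[i]) (psi : 'rV[R]_N -> R) :
  loc_integrable f -> cc psi ->
  conjc (inner (fun x => (psi x)%:C) f) = pairing f psi.
Proof.
move=> lf cpsi; rewrite pairingE /inner /cintegral /conjc; congr (_ +i* _).
  by apply: eq_Rintegral => x _; case: (f x) => a b; simpc; rewrite /= mulrC.
have [_ i1] := lf _ cpsi.
rewrite -[RHS]mul1r -[X in _ = X * _](opprK 1) mulNr; congr (- _).
rewrite -RintegralZl//.
by apply: eq_Rintegral => x _; case: (f x) => a b; simpc; rewrite /=; ring.
Qed.

(** Tested with [psi] of charge 0, the form of f + c G keeps only the gradient term, which is minus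
    the pairing of f with the Laplacian of [psi], and lambda c times the pairing of G with [psi],
    with a minus sign. As [psi] vanishes at 0, the Green equation turns the latter into c times the
    pairing of G with the Laplacian, and the two terms recombine into the solution. *)
Lemma weak_equation (psi : 'rV[R]_N -> R) : A0 alpha p lambda G (radial N phi) ->
  test_function psi ->
  (exists2 d : R, 0 < d & forall x, sqnorm x < d -> psi x = 0) ->
  \int[mu]_x (phi (enorm x) * laplacian psi x) =
  \int[mu]_x (phi (enorm x) `^ p * psi x).
Proof.
move=> [_ [u uE uA]] tpsi [d d0 psid].
have C1 i := test_function_C1c i tpsi.
have tpart i := test_function_partial i tpsi.
have C2 i := test_function_C1c i (tpart i).
have lf : loc_integrable (X0_reg u).
  by apply: memLp_loc_integrable (X0_regP u); rewrite lerDr (le_trans _ (ltW p1)).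
have lG : loc_integrable G by apply: memLp_loc_integrable hG.1; rewrite ler1n.
have cc1 i : cc (partial i psi) := (C1c_cc (C1 i)).2.
have cc2 i : cc (partial i (partial i psi)) := (C1c_cc (C2 i)).2.
have ccpsi : cc psi.
  have [M _ HM] := test_function_cube tpsi; split; last by exists M.
  exact: (tpsi.1 [::]).1.
have p10 : 0 < p + 1 by rewrite addr_gt0// (lt_trans ltr01).
have wgrad i : weak_partial i (fun x => (psi x)%:C) (fun x => (partial i psi x)%:C).
  move=> chi tchi.
  have := C1c_integration_by_parts (C1 i) (test_function_C1c i tchi).
  rewrite -/(pairing _ _) -/(pairing _ _) !pairingE /=.
  have E (h : 'rV[R]_N -> R) : \int[mu]_x (0 * h x) = 0.
    transitivity (\int[mu]_x (cst 0 x : R)); last by rewrite Rintegral_cst// mul0r.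
    by apply: eq_Rintegral => x _; rewrite mul0r.
  by rewrite !E => ->; apply/eqP; rewrite eq_complex /= oppr0 !eqxx.
pose w : X0 p G := {| X0_reg := fun x => (psi x)%:C;
  X0_grad := fun i x => (partial i psi x)%:C; X0_charge := 0;
  X0_regP := cc_memLp p10 ccpsi;
  X0_gradP := fun i => conj (wgrad i) (cc_memLp (ltr0n _ 2) (cc1 i)) |}.
have wE : X0_fun w = (fun x => (psi x)%:C).
  by apply/funext => x; rewrite /X0_fun /= mul0r addr0.
have conj0 : conjc (0 : R[i]) = 0.
  by apply/eqP; rewrite eq_complex /= oppr0 !eqxx.
have lapE : pairing (X0_reg u) (laplacian psi) =
    - \sum_i inner (X0_grad u i) (fun x => (partial i psi x)%:C).
  rewrite [LHS](pairing_sum _ lf cc2) -sumrN; apply: eq_bigr => i _.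
  by rewrite inner_real; exact: (X0_gradP u i).1 (tpart i).
have cclap : cc (laplacian psi) by exact: cc_sum cc2.
have greenE : lambda%:C * pairing G psi = pairing G (laplacian psi).
  have := hG.2 psi tpsi; rewrite psid; last first.
    by rewrite /sqnorm big1// => i _; rewrite mxE expr0n.
  have -> : (fun x => G x * (lambda * psi x - laplacian psi x)%:C) =
      (fun x => G x * (lambda * psi x + (-1) * laplacian psi x)%:C).
    by apply/funext => x; rewrite mulN1r.
  rewrite -[LHS]/(pairing G _) (pairing_lin _ _ lG ccpsi cclap) => /eqP.
  by rewrite rmorphN1 mulN1r subr_eq0 => /eqP.
have := uA w; rewrite /delta_form wE [X0_charge w]/= conj0 !(mulr0, mul0r) addr0 subr0.
rewrite conjc_inner_real// mulrAC greenE inner_real.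
rewrite -[X in X - _ + _]opprK -lapE -opprD.
rewrite [_ * X0_charge u]mulrC -pairing_add// => /eqP.
rewrite addrC subr_eq0 => /eqP.
rewrite (_ : (fun x => X0_reg u x + X0_charge u * G x) = radial N phi)//.
rewrite !pairingE => /(congr1 (@complex.Re R))/= E.
transitivity (\int[mu]_x (Re (radial N phi x) * laplacian psi x)); first by [].
rewrite -E; apply: eq_Rintegral => x _.
(* Positivity of [phi] is known only for positive radii; where [psi] is nonzero, x is away from the
   origin. *)
have [->|px] := eqVneq (psi x) 0; first by rewrite !mulr0.
have x0 : 0 < enorm x.
  rewrite sqrtr_gt0 (lt_le_trans d0)// leNgt; apply: contra px => /psid ->.
  by rewrite eqxx.
rewrite expr0n addr0 mulr0 subr0 sqrtr_sqr gtr0_norm ?phi_gt0//.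
rewrite [_ * phi _]mulrC mulr_powRB1 ?(ltW (phi_gt0 x0))//.
exact: lt_trans p1.
Qed.

End weak_equation.

(** * Decay and square integrability *)

Section vanishing.
Context {R : realType} (k : nat).
Local Notation E := 'rV[R]_k.+1.
Local Notation mu := (@lebesgue_rV R k.+1).
Local Notation normc := (@ComplexField.Normc.normc R).

Lemma coord_le_enorm n (x : 'rV[R]_n) (i : 'I_n) : `|x 0 i| <= enorm x.
Proof.
rewrite /enorm -sqrtr_sqr ler_wsqrtr// (bigD1 i)//= lerDl.
by apply: sumr_ge0 => j _; rewrite sqr_ge0.
Qed.

(** If phi >= e everywhere, then at each x != 0 one of |f| and |c G| is at least e / 2, so 1 <= F +
    H there, although F + H has finite integral C. *)
Lemma radial_vanishing (phi : R -> R) (q : R) (f G : E -> R[i]) (c : R[i]) :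
  0 < q -> memLp q f -> memLp 2 G -> (forall r, 0 < r -> 0 < phi r) ->
  radial k.+1 phi = (fun x => f x + c * G x) ->
  forall e, 0 < e -> exists2 b, 0 < b & phi b < e.
Proof.
move=> q0 fq G2 phi_gt0 phiE e e0; apply: contrapT => nphi.
have phi_e b : 0 < b -> e <= phi b.
  by move=> b0; rewrite leNgt; apply/negP => pb; apply: nphi; exists b.
pose F x := (2 / e) `^ q * normc (f x) `^ q.
pose H x := (2 * normc c / e) `^ 2 * normc (G x) `^ 2.
have iF : mu.-integrable setT (EFin \o F).
  have := @integrableZl _ _ _ mu setT measurableT ((2 / e) `^ q) _ (memLp_integrable q0 fq).
  by apply.
have iH : mu.-integrable setT (EFin \o H).
  have := @integrableZl _ _ _ mu setT measurableT ((2 * normc c / e) `^ 2) _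
    (memLp_integrable (ltr0n R 2) G2).
  by apply.
have F0 x : 0 <= F x by rewrite mulr_ge0 ?powR_ge0.
have H0 x : 0 <= H x by rewrite mulr_ge0 ?powR_ge0.
have iFH : mu.-integrable setT (EFin \o (fun x => F x + H x)) by exact: (integrableD measurableT iF iH).
pose C := \int[mu]_x (F x + H x).
have C0 : 0 <= C by apply: Rintegral_ge0 => x _; rewrite addr_ge0.
(* The box avoids the origin, and its side C + 1 >= 1 makes its volume at least C + 1. *)
pose box : set E := [set x | forall i, `[1, C + 2]%classic (x 0 i)].
have mbox : measurable box.
  apply: (@measurable_rV_box _ _ (fun=> `[1, C + 2]%classic)) => i.
  exact: measurable_itv.
have mubox : mu box = ((C + 1) ^+ k.+1)%:E.
  rewrite [LHS](lebesgue_rV_box (A := fun=> `[1, C + 2]%classic)); last by move=> i; exact: measurable_itv.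
  rewrite (eq_bigr (fun=> (C + 1)%:E)) => [|i _]; first exact: prod_cst_EFin.
  rewrite lebesgue_measure_itv/= lte_fin ifT; last by lra.
  by rewrite -EFinB; congr (_%:E); ring.
have ibox : mu.-integrable setT (EFin \o (\1_box : E -> R)).
  apply: (@integrable_cube _ _ (C + 2) _ 1); first exact: measurable_indic.
  move=> x; rewrite indicE; case: (boolP (x \in box)) => [|_]; last by rewrite eqxx.
  rewrite inE => bx _; split; last by rewrite normr1.
  by move=> i; have := bx i; rewrite /= in_itv/= => /andP[x1 x2]; rewrite ger0_norm//; lra.
have : \int[mu]_x (\1_box x : R) <= C.
  apply: le_Rintegral => // x _; rewrite indicE; case: (boolP (x \in box)) => [|_]; last first.
    by rewrite addr_ge0.
  rewrite inE => bx.
  have x0 : 0 < enorm x.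
    apply: lt_le_trans (coord_le_enorm x ord0).
    by have := bx ord0; rewrite /= in_itv/= => /andP[x1 x2]; rewrite ger0_norm//; lra.
  have fG : e <= normc (f x) + normc c * normc (G x).
    apply: (le_trans (phi_e _ x0)); rewrite -ComplexField.Normc.normcM.
    apply: le_trans (le_normcD _ _).
    have -> : f x + c * G x = radial k.+1 phi x by rewrite phiE.
    by rewrite normc_real ler_norm.
  have [fe|fe] := leP e (2 * normc (f x)).
    rewrite ler_wpDr// /F -powRM ?normc_ge0 ?divr_ge0 ?(ltW e0)//.
    rewrite (_ : _%:R = 1 `^ q); last by rewrite powR1.
    rewrite le_powR ?(ltW q0)//.
    by rewrite mulrAC ler_pdivlMr// mul1r.
  rewrite ler_wpDl// /H -powRM ?normc_ge0 ?divr_ge0 ?mulr_ge0 ?normc_ge0 ?(ltW e0)//.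
  rewrite [leLHS](_ : _ = 1 `^ 2); last by rewrite powR1.
  rewrite le_powR//.
  by rewrite mulrAC ler_pdivlMr// mul1r; lra.
rewrite /Rintegral integral_indic// setIT [X in fine X]mubox/=.
have : (C + 1) <= (C + 1) ^+ k.+1 by rewrite exprS ler_peMr ?exprn_ege1//; lra.
lra.
Qed.

End vanishing.

Section square_integrability.
Context {R : realType} (k : nat).
Local Notation E := 'rV[R]_k.+1.
Local Notation mu := (@lebesgue_rV R k.+1).
Local Notation normc := (@ComplexField.Normc.normc R).

(** Cubes replace balls because their measure is explicit; on a shell the Euclidean norm is still
    comparable with 2^j. *)
Definition dyadic_cube (j : nat) : set E := cube (2 ^+ j).

Definition dyadic_shell (j : nat) : set E := dyadic_cube j.+1 `\` dyadic_cube j.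

Lemma measurable_dyadic_cube j : measurable (dyadic_cube j).
Proof. exact: measurable_cube. Qed.

Lemma measurable_dyadic_shell j : measurable (dyadic_shell j).
Proof. by apply: measurableD; exact: measurable_cube. Qed.

Lemma subset_dyadic_cube i j : (i <= j)%N -> dyadic_cube i `<=` dyadic_cube j.
Proof.
move=> ij x xi l; apply: (le_trans (xi l)).
by rewrite ler_weXn2l// ler1n.
Qed.

Lemma bigcup_dyadic_cube : \bigcup_j dyadic_cube j = setT.
Proof.
apply/seteqP; split=> // x _; pose M := `|x|.
have [j Mj] : exists j : nat, M <= 2 ^+ j.
  exists (Num.truncn M).+1; rewrite (le_trans (ltW (truncnS_gt M)))//.
  by rewrite -natrX ler_nat ltnW// ltn_expl.
by exists j => // i; rewrite (le_trans (coord_le_norm x i)).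
Qed.

Lemma dyadic_shell_sqnorm j x : dyadic_shell j x ->
  (2 ^+ j) ^+ 2 < sqnorm x <= (k.+1)%:R * (2 ^+ j.+1) ^+ 2.
Proof.
move=> [xj1 xj]; apply/andP; split.
  have [i /negP] : exists i, ~ (`|x 0 i| <= 2 ^+ j) by exact/existsNP.
  rewrite -ltNge => xi.
  apply: (@lt_le_trans _ _ (x 0 i ^+ 2)).
    by rewrite -[ltRHS]real_normK ?num_real// ltrXn2r ?nnegrE// exprn_ge0.
  rewrite /sqnorm (bigD1 i)//= lerDl.
  by apply: sumr_ge0 => l _; rewrite sqr_ge0.
rewrite /sqnorm (le_trans (ler_sum _ (fun i _ => _ : _ <= (2 ^+ j.+1) ^+ 2)))//.
  move=> i _; rewrite -[x 0 i ^+ 2]real_normK ?num_real//.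
  by rewrite lerXn2r ?nnegrE ?exprn_ge0//; exact: xj1.
by rewrite sumr_const card_ord mulr_natl.
Qed.

Lemma dyadic_shell_enorm j x : dyadic_shell j x -> 2 ^+ j <= enorm x.
Proof.
move=> /dyadic_shell_sqnorm /andP[xj _].
have j0 : 0 <= 2 ^+ j :> R by rewrite exprn_ge0.
by rewrite -(ger0_norm j0) -sqrtr_sqr ler_wsqrtr// ltW.
Qed.

Lemma lebesgue_dyadic_cube j : mu (dyadic_cube j) = ((2 * 2 ^+ j) ^+ k.+1)%:E.
Proof. by rewrite [LHS]lebesgue_cube// exprn_ge0. Qed.

Variable F : E -> R.
Hypothesis mF : measurable_fun [set: E] F.
Hypothesis F_ge0 : forall x, 0 <= F x.
Let I j : \bar R := (\int[mu]_(x in dyadic_cube j) (F x)%:E)%E.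

Let mFE : measurable_fun [set: E] (EFin \o F).
Proof. exact/measurable_EFinP. Qed.

Lemma integral_dyadic_step j :
  (I j.+1 = I j + \int[mu]_(x in dyadic_shell j) (F x)%:E)%E.
Proof.
rewrite /I -(setDUK (subset_dyadic_cube (leqnSn j))) ge0_integral_setU//.
- exact: measurable_dyadic_cube.
- exact: measurable_dyadic_shell.
- exact: measurable_funTS.
- by move=> x _; rewrite lee_fin.
- by rewrite disj_set2E setDIK.
Qed.

Lemma integral_dyadic_lty (D q : R) : 0 <= D -> 0 <= q -> q < 1 -> (I 0 < +oo)%E ->
  (forall j, (\int[mu]_(x in dyadic_shell j) (F x)%:E <= (D * q ^+ j)%:E)%E) ->
  (\int[mu]_x (F x)%:E < +oo)%E.
Proof.
move=> D0 q0 q1 I0 ID.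
have IB j : (I j <= I 0 + (D * ((1 - q ^+ j) / (1 - q)))%:E)%E.
  elim: j => [|j IH]; first by rewrite expr0 subrr mul0r mulr0 adde0.
  rewrite integral_dyadic_step (le_trans (leeD IH (ID j)))// -addeA -EFinD leeD2l// lee_fin.
  rewrite -mulrDr ler_wpM2l// exprS le_eqVlt; apply/orP; left; apply/eqP; field.
  by rewrite subr_eq0 gt_eqF.
have IB' j : (I j <= I 0 + (D / (1 - q))%:E)%E.
  apply: (le_trans (IB j)); rewrite leeD2l// lee_fin ler_wpM2l//.
  rewrite ler_pdivrMr ?subr_gt0// mulVf ?gt_eqF ?subr_gt0//.
  by rewrite gerBl exprn_ge0.
have cvgI : I j @[j --> \oo] --> (\int[mu]_x (F x)%:E)%E.
  rewrite -bigcup_dyadic_cube; apply: ge0_nondecreasing_set_cvg_integral.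
  - by apply/nondecreasing_seqP => j; rewrite subsetEset; exact: subset_dyadic_cube.
  - exact: measurable_dyadic_cube.
  - by move=> j; exact: measurable_funTS.
  - by move=> j x _; rewrite lee_fin.
apply: (@le_lt_trans _ _ (I 0 + (D / (1 - q))%:E)%E); last by rewrite lte_add_pinfty// ltry.
rewrite -(cvg_lim _ cvgI)//; apply: lime_le; first by apply/cvg_ex; eexists; exact: cvgI.
by apply: nearW => j; exact: IB'.
Qed.

(** The j-th cube contains j disjoint shells, so its integral is at least j d. *)
Lemma integral_dyadic_infty (d : R) : 0 < d ->
  (forall j, (d%:E <= \int[mu]_(x in dyadic_shell j) (F x)%:E)%E) ->
  ~ (\int[mu]_x (F x)%:E < +oo)%E.
Proof.
move=> d0 dI Ioo.
have dj j : ((d *+ j)%:E <= I j)%E.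
  elim: j => [|j IH]; first by rewrite mulr0n; apply: integral_ge0 => x _; rewrite lee_fin.
  by rewrite integral_dyadic_step mulrSr EFinD leeD.
have IT j : (I j <= \int[mu]_x (F x)%:E)%E.
  apply: ge0_subset_integral => //; [exact: measurable_dyadic_cube|].
  by move=> x _; rewrite lee_fin.
have I0 : (0 <= \int[mu]_x (F x)%:E)%E by apply: integral_ge0 => x _; rewrite lee_fin.
have : (\int[mu]_x (F x)%:E)%E \is a fin_num by rewrite ge0_fin_numE.
move=> /fineK IE.
have := le_trans (dj (Num.truncn (fine (\int[mu]_x (F x)%:E)%E / d)).+1) (IT _).
rewrite -IE lee_fin -mulr_natl -ler_pdivlMr// leNgt.
by rewrite truncnS_gt.
Qed.

End square_integrability.

Section radial_L2.
Context {R : realType} (k : nat).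
Local Notation E := 'rV[R]_k.+1.
Local Notation mu := (@lebesgue_rV R k.+1).
Local Notation normc := (@ComplexField.Normc.normc R).
Variables (phi : R -> R) (q : R) (f G : E -> R[i]) (c : R[i]).
Hypotheses (q2 : 2 <= q) (fq : memLp q f) (G2 : memLp 2 G).
Hypothesis phi_gt0 : forall r, 0 < r -> 0 < phi r.
Hypothesis phiE : radial k.+1 phi = (fun x => f x + c * G x).

Lemma cmeasurable_radial : cmeasurable (radial k.+1 phi).
Proof.
rewrite phiE; have [[fr fi] _] := fq; have [[Gr Gi] _] := G2.
case: c => a b; split.
  rewrite (_ : (fun x => _) = (fun x => complex.Re (f x) +
    (a * complex.Re (G x) - b * complex.Im (G x)))); last first.
    by apply/funext => x; case: (f x) (G x) => [? ?] [? ?]; simpc.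
  by apply: measurable_funD => //; apply: measurable_funB; exact: measurable_funM.
rewrite (_ : (fun x => _) = (fun x => complex.Im (f x) +
    (a * complex.Im (G x) + b * complex.Re (G x)))); last first.
  by apply/funext => x; case: (f x) (G x) => [? ?] [? ?]; simpc.
by apply: measurable_funD => //; apply: measurable_funD; exact: measurable_funM.
Qed.

Let F (x : E) := normc (radial k.+1 phi x) `^ 2.

Let mF : measurable_fun [set: E] F.
Proof.
apply: (measurableT_comp (measurable_powR 2)).
exact: (measurable_normc cmeasurable_radial).
Qed.

Let F0 x : 0 <= F x. Proof. exact: powR_ge0. Qed.

Let FE x : 0 < enorm x -> F x = phi (enorm x) ^+ 2.
Proof.
move=> x0; rewrite /F normc_real gtr0_norm ?phi_gt0//.
by rewrite powR_mulrn// ltW// phi_gt0.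
Qed.

Lemma radial_memLp2 : memLp 2 (radial k.+1 phi) <-> (\int[mu]_x (F x)%:E < +oo)%E.
Proof.
split=> [[_ /Lnormc_lty]|Foo]; first by apply.
by split; [exact: cmeasurable_radial|exact/Lnormc_lty].
Qed.

(** The decay bound says nothing near the origin; there the decomposition does, through |f + c G|^2
    <= 2 |f|^2 + 2 |c G|^2 and |f|^2 <= 1 + |f|^q for q >= 2. *)
Lemma radial_locally_L2 : (\int[mu]_(x in @dyadic_cube R k 0) (F x)%:E < +oo)%E.
Proof.
have q0 : 0 < q by exact: lt_le_trans q2.
pose Q := @dyadic_cube R k 0.
pose H x : R := 2 * (\1_Q x + normc (f x) `^ q) + 2 * normc c `^ 2 * normc (G x) `^ 2.
have iQ : mu.-integrable setT (EFin \o (\1_Q : E -> R)).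
  apply: (@integrable_cube _ _ (2 ^+ 0) _ 1).
    by apply: measurable_indic; exact: measurable_dyadic_cube.
  by move=> x; rewrite indicE; case: (boolP (x \in Q)) => [|_]; rewrite ?inE ?normr1 ?eqxx.
have iH : mu.-integrable setT (EFin \o H).
  have i1 := @integrableZl _ _ _ mu setT measurableT 2 _
    (integrableD measurableT iQ (memLp_integrable q0 fq)).
  have i2 := @integrableZl _ _ _ mu setT measurableT (2 * normc c `^ 2) _
    (memLp_integrable (ltr0n R 2) G2).
  by have := integrableD measurableT i1 i2; apply.
have H0 x : 0 <= H x.
  by rewrite addr_ge0// !mulr_ge0 ?powR_ge0// addr_ge0 ?powR_ge0.
have : (\int[mu]_(x in Q) (F x)%:E <= \int[mu]_(x in Q) (H x)%:E)%E.
  have mH : measurable_fun [set: E] (EFin \o H) by case/integrableP : iH.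
  apply: ge0_le_integral => //.
  - exact: measurable_dyadic_cube.
  - by move=> x _; rewrite lee_fin.
  - by apply/measurable_EFinP; exact: measurable_funTS.
  - exact: measurable_funTS.
  - move=> x Qx; rewrite lee_fin /F /H phiE indicE mem_set// !powR_mulrn ?normc_ge0//.
    have := le_normcD (f x) (c * G x).
    rewrite ComplexField.Normc.normcM.
    set u := normc (f x); set v := normc c; set w := normc (G x).
    have u0 : 0 <= u by exact: normc_ge0.
    have v0 : 0 <= v by exact: normc_ge0.
    have w0 : 0 <= w by exact: normc_ge0.
    have uq : u ^+ 2 <= 1 + u `^ q.
      have [u1|u1] := leP u 1.
        by rewrite ler_wpDr ?powR_ge0// exprn_ile1.
      by rewrite ler_wpDl// -powR_mulrn// ler_powR// ltW.
    have := normc_ge0 (f x + c * G x).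
    set s := normc _ => s0 suvw.
    have : s ^+ 2 <= (u + v * w) ^+ 2 by rewrite lerXn2r// nnegrE (le_trans s0).
    have := sqr_ge0 (u - v * w).
    by rewrite mulr1n; nra.
move=> /le_lt_trans; apply.
apply: (@le_lt_trans _ _ (\int[mu]_x (H x)%:E)%E).
  apply: ge0_subset_integral => //; [exact: measurable_dyadic_cube| |].
    by case/integrableP : iH.
  by move=> x _; rewrite lee_fin.
have /integrableP[_] := iH.
by under eq_integral do rewrite /= ger0_norm//.
Qed.

Lemma radial_L2_of_decay (a C : R) : 0 < C -> 0 < a ->
  (forall r, 1 <= r -> phi r <= C * r `^ (- a)) -> (k.+1)%:R < 2 * a ->
  memLp 2 (radial k.+1 phi).
Proof.
move=> C0 a0 phiC ka; apply/radial_memLp2.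
pose t : R := 2 `^ (- a).
have t0 : 0 < t by exact: powR_gt0.
(* On shell j the function is at most (C t^j)^2, and the shell lies in a cube of side 4 * 2^j. The
   ratio is 2^(k+1-2a), below 1 by the hypothesis on [a]. *)
apply: (@integral_dyadic_lty _ _ _ mF F0 (C ^+ 2 * 4 ^+ k.+1) (2 ^+ k.+1 * t ^+ 2)).
- by rewrite mulr_ge0// exprn_ge0// ltW.
- by rewrite mulr_ge0// exprn_ge0// ltW.
- rewrite -!powR_mulrn// ?(ltW t0)// /t -powRrM -powRD; last by rewrite pnatr_eq0 implybT.
  rewrite /powR pnatr_eq0 expR_lt1 pmulr_llt0 ?ln_gt0 ?ltr1n//; lra.
- exact: radial_locally_L2.
move=> j; apply: (@le_trans _ _ (\int[mu]_(x in @dyadic_shell R k j) ((C * t ^+ j) ^+ 2)%:E)%E).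
  apply: ge0_le_integral => //.
  - exact: measurable_dyadic_shell.
  - by move=> x _; rewrite lee_fin.
  - by apply/measurable_EFinP; exact: measurable_funTS.
  - move=> x /dyadic_shell_enorm xj; rewrite lee_fin.
    have j1 : 1 <= 2 ^+ j :> R by rewrite exprn_ege1// ler1n.
    have x1 : 1 <= enorm x by exact: le_trans xj.
    have x0 : 0 < enorm x by exact: lt_le_trans x1.
    rewrite FE// lerXn2r ?nnegrE ?(ltW (phi_gt0 x0)) ?mulr_ge0 ?exprn_ge0 ?(ltW C0) ?(ltW t0)//.
    rewrite (le_trans (phiC _ x1))// ler_wpM2l ?(ltW C0)//.
    rewrite powR_exprAC//.
    rewrite !powRN lef_pV2 ?posrE ?powR_gt0 ?(lt_le_trans _ j1)//.
    by rewrite le_powR// ?(ltW a0) ?exprn_ge0.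
rewrite integral_cst//; last exact: measurable_dyadic_shell.
apply: (@le_trans _ _ (((C * t ^+ j) ^+ 2)%:E * mu (@dyadic_cube R k j.+1))%E).
  rewrite lee_wpmul2l ?lee_fin ?sqr_ge0// le_measure ?inE//.
  - exact: measurable_dyadic_shell.
  - exact: measurable_dyadic_cube.
  - by move=> x [].
rewrite lebesgue_dyadic_cube -EFinM lee_fin le_eqVlt; apply/orP; left; apply/eqP.
have -> : 2 * 2 ^+ j.+1 = 4 * 2 ^+ j :> R by rewrite exprS mulrA -natrM.
rewrite exprMn [(4 * _) ^+ _]exprMn [(t ^+ j) ^+ 2]exprAC [(2 ^+ j) ^+ k.+1]exprAC.
by rewrite mulrACA [(2 ^+ k.+1 * _) ^+ j]exprMn; congr (_ * _); rewrite mulrC.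
Qed.

End radial_L2.

Lemma radial_not_L2 (R : realType) (phi : R -> R) (q : R) (f G : 'rV[R]_2 -> R[i])
    (c0 : R[i]) (a c : R) : 2 <= q -> memLp q f -> memLp 2 G ->
  (forall r, 0 < r -> 0 < phi r) ->
  radial 2 phi = (fun x => f x + c0 * G x) ->
  0 < c -> a <= 1 -> (forall r, 1 <= r -> c * r `^ (- a) <= phi r) ->
  ~ memLp 2 (radial 2 phi).
Proof.
move=> q2 fq G2 phi_gt0 phiE c_gt0 a1 phic /(radial_memLp2 fq G2 phiE).
have mF : measurable_fun [set: 'rV[R]_2]
    (fun x => ComplexField.Normc.normc (radial 2 phi x) `^ 2).
  apply: (measurableT_comp (measurable_powR 2)).
  exact: (measurable_normc (cmeasurable_radial fq G2 phiE)).
(* As a <= 1, phi >= c / r. On shell j, |x|^2 <= 8 * 4^j and the measure is 12 * 4^j, so each shell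
   contributes at least 12 c^2 / 8. *)
apply: (@integral_dyadic_infty _ _ _ mF (fun=> powR_ge0 _ _) (c ^+ 2 * 3 / 2)).
  by rewrite divr_gt0// mulr_gt0// exprn_gt0.
move=> j.
apply: (@le_trans _ _ (\int[@lebesgue_rV R 2]_(x in @dyadic_shell R 1 j)
    (c ^+ 2 / (2 * (2 ^+ j.+1) ^+ 2))%:E)%E); last first.
  apply: ge0_le_integral => //.
  - exact: measurable_dyadic_shell.
  - by move=> x _; rewrite lee_fin divr_ge0 ?mulr_ge0 ?exprn_ge0 ?(ltW c_gt0).
  - by apply/measurable_EFinP; exact: measurable_funTS.
  - move=> x Sx; rewrite lee_fin.
    have /dyadic_shell_sqnorm/andP[xj1 xj2] := Sx.
    have xj := dyadic_shell_enorm Sx.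
    have j1 : 1 <= 2 ^+ j :> R by rewrite exprn_ege1// ler1n.
    have x1 : 1 <= enorm x by exact: le_trans xj.
    have x0 : 0 < enorm x by exact: lt_le_trans x1.
    have s0 : 0 < sqnorm x by rewrite (lt_trans _ xj1)// !exprn_gt0.
    rewrite normc_real gtr0_norm ?phi_gt0// powR_mulrn ?(ltW (phi_gt0 _ x0))//.
    have : c / enorm x <= phi (enorm x).
      apply: le_trans (phic _ x1); rewrite ler_wpM2l ?(ltW c_gt0)//.
      rewrite powRN lef_pV2 ?posrE ?powR_gt0//.
      by rewrite -[leRHS]powRr1 ?(ltW x0)// ler_powR.
    move=> cphi; apply: (@le_trans _ _ ((c / enorm x) ^+ 2)).
      rewrite expr_div_n ler_wpM2l ?sqr_ge0// lef_pV2 ?posrE ?mulr_gt0 ?exprn_gt0//.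
      by rewrite /enorm sqr_sqrtr ?(ltW s0).
    by rewrite lerXn2r ?nnegrE ?(ltW (phi_gt0 _ x0)) ?divr_ge0 ?(ltW x0) ?(ltW c_gt0).
rewrite integral_cst//; last exact: measurable_dyadic_shell.
have muS : lebesgue_rV 2 (@dyadic_shell R 1 j) = (12 * (2 ^+ j) ^+ 2)%:E.
  rewrite /dyadic_shell measureD; [|exact: measurable_dyadic_cube..|].
    have /setIidPr -> := @subset_dyadic_cube R 1 j j.+1 (leqnSn j).
    rewrite [X in (X - _)%E]lebesgue_dyadic_cube [X in (_ - X)%E]lebesgue_dyadic_cube.
    by rewrite -EFinB [2 ^+ j.+1]exprS; congr (_%:E); ring.
  by rewrite [ltLHS]lebesgue_dyadic_cube ltry.
rewrite [X in (_ <= _ * X)%E]muS -EFinM lee_fin le_eqVlt; apply/orP; left; apply/eqP.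
by rewrite [2 ^+ j.+1]exprS; field; rewrite expf_neq0.
Qed.

(** * The bounds for the solution of the point-interaction equation and their consequences *)

Lemma A0_two_sided_bound (R : realType) (k : nat) (alpha p lambda : R)
    (G : 'rV[R]_k.+1 -> R[i]) (phi : R -> R) :
  1 < p -> is_green lambda G -> A0 alpha p lambda G (radial k.+1 phi) ->
  (forall r, 0 < r -> 0 < phi r) ->
  (forall r s, 0 < r -> r <= s -> phi s <= phi r) ->
  k%:R < 2 / (p - 1) + 1 ->
  exists c C : R, [/\ 0 < c, 0 < C &
     forall r, 1 <= r ->
       c * r `^ (- (2 / (p - 1))) <= phi r <= C * r `^ (- (2 / (p - 1)))].
Proof.
move=> p1 hG hphi phi_gt0 phi_decr kp.
have p0 : 0 < p by exact: lt_trans p1.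
have [_ [u uE _]] := hphi.
have G2 : memLp 2 G := hG.1.
apply: two_sided_power_bound kp => // [e e0|e e14].
  exact: (radial_vanishing (addr_gt0 p0 ltr01) (X0_regP u) G2 phi_gt0 uE e0).
apply: (mollified_bump phi_gt0 phi_decr p0 _ _ e14).
  exact: (cmeasurable_radial (X0_regP u) G2 uE).1.
move=> psi tpsi psi0; exact: (weak_equation p1 hG phi_gt0 hphi tpsi psi0).
Qed.

Local Close Scope complex_scope.

Theorem theorem1p5 (R : realType) (N : nat) (alpha p : R)
    (hNp : (N = 2%N /\ 1 < p) \/ (N = 3%N /\ alpha < 0 /\ 1 < p < 2))
    (lambda : R) (hlambda : 0 < lambda)
    (G : 'rV[R]_N -> R[i]) (hG : is_green lambda G)
    (phi0 : R -> R)
    (hphi0 : A0 alpha p lambda G (radial N phi0))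
    (hpos : forall r, 0 < r -> 0 < phi0 r)
    (hdecr : forall r s, 0 < r -> r <= s -> phi0 s <= phi0 r) :
  (exists c C : R, [/\ 0 < c, 0 < C &
     forall r, 1 <= r ->
       c * r `^ (- (2 / (p - 1))) <= phi0 r <= C * r `^ (- (2 / (p - 1)))]) /\
  (N = 2%N -> memLp 2 (radial N phi0) <-> 1 < p < 3) /\
  (N = 3%N -> memLp 2 (radial N phi0)).
Proof.
have G2 : memLp 2 G := hG.1.
have [_ [u uE _]] := hphi0.
have up := X0_regP u.
case: hNp => [[N2 p1]|[N3 [_ /andP[p1 p2]]]]; subst N.
  have p10 : 0 < p - 1 by rewrite subr_gt0.
  have a0 : 0 < 2 / (p - 1) by rewrite divr_gt0.
  have q2 : 2 <= p + 1 by lra.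
  have [|c [C [c0 C0 cC]]] := A0_two_sided_bound p1 hG hphi0 hpos hdecr.
    (* Here k = 1, and the condition on the exponent is just a > 0. *)
    by rewrite ltrDr.
  split; first by exists c, C.
  split=> // _; split=> [L2|/andP[_ p3]].
    rewrite p1 ltNge; apply/negP => p3.
    apply: (@radial_not_L2 _ _ _ _ _ _ (2 / (p - 1)) _ q2 up G2 hpos uE c0 _ _ L2) => [|r /cC/andP[]//].
    (* The case p >= 3 is exactly a <= 1. *)
    by rewrite ler_pdivrMr//; lra.
  apply: (radial_L2_of_decay q2 up G2 hpos uE C0 a0) => [r /cC/andP[]//|].
  by rewrite mulrA ltr_pdivlMr//; lra.
have p10 : 0 < p - 1 by rewrite subr_gt0.
(* From p < 2 one gets a > 2, which yields both 2 < a + 1 for the subsolution and 3 < 2 a for square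
   integrability. *)
have a2 : 2 < 2 / (p - 1) by rewrite ltr_pdivlMr//; lra.
have [|c [C [c0 C0 cC]]] := A0_two_sided_bound p1 hG hphi0 hpos hdecr.
  lra.
split; first by exists c, C.
split=> // _.
apply: (radial_L2_of_decay _ up G2 hpos uE C0 (lt_trans _ a2)) => [||r /cC/andP[]//|]; lra.
Qed.
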